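(* Let $(\underline{\alpha}^{(j)},\underline{x}^{(j)},\psi^{(j)})_{1\le j\le\ell}$ be a finite family of triplets of scales, cores and profiles such that the scales are pairwise orthogonal, and set $$g_n(x)=\sum_{j=1}^{\ell}\sqrt{\frac{\alpha_n^{(j)}}{2\pi}}\ \psi^{(j)}\left(\frac{-\log|x-x_n^{(j)}|}{\alpha_n^{(j)}}\right)=:\sum_{j=1}^{\ell}g_n^{(j)}(x).$$ Then, as $n\to\infty$, $$\|g_n\|_{\mathcal L}\to\sup_{1\le j\le\ell}\left(\lim_{n\to\infty}\|g_n^{(j)}\|_{\mathcal L}\right)=\sup_{1\le j\le\ell}\left(\frac{1}{\sqrt{4\pi}}\max_{s>0}\frac{|\psi^{(j)}(s)|}{\sqrt s}\right).$$
   Context: Orlicz norm: set $\kappa:=\sup_{\|u\|_{H^1(\mathbb{R}^2)}\le1}\int_{\mathbb{R}^2}\left(e^{4\pi|u|^2}-1\right)dx<\infty$, where $\|u\|_{H^1}^2=\|u\|_{L^2}^2+\|\nabla u\|_{L^2}^2$, and $$\|u\|_{\mathcal L}=\inf\Big\{\lambda>0:\ \int_{\mathbb{R}^2}\left(e^{|u(x)|^2/\lambda^2}-1\right)dx\le\kappa\Big\}.$$ A scale is a sequence $\underline{\alpha}=(\alpha_n)$ of positive real numbers tending to $\infty$. Two scales $(\alpha_n)$ and $(\beta_n)$ are orthogonal if $|\log(\beta_n/\alpha_n)|\to\infty$. A core is a sequence $\underline{x}=(x_n)$ of points of $\mathbb{R}^2$. A profile is an element of $$\mathcal P:=\{\psi\in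 L^2(\mathbb{R},e^{-2s}ds):\ \psi'\in L^2(\mathbb{R}),\ \psi|_{]-\infty,0]}=0\}$$ (profiles are continuous, and $\psi(s)/\sqrt s\to0$ as $s\to0^+$ and as $s\to\infty$). *)

(* Defs.v *)
From HB Require Import structures.
From mathcomp Require Import all_boot all_order all_algebra.
From mathcomp Require Import all_classical all_reals all_analysis.

Set Implicit Arguments.
Unset Strict Implicit.
Unset Printing Implicit Defensive.

Import Order.TTheory GRing.Theory Num.Theory.
Import numFieldNormedType.Exports.

Local Open Scope classical_set_scope.
Local Open Scope ring_scope.

(* [R * R] carries the sup norm in the library: the Euclidean norm has to be
   given separately. *)
Definition enorm {R : realType} (x : R * R) : R :=
  Num.sqrt (x.1 ^+ 2 + x.2 ^+ 2).

Definition leb1 (R : realType) : {measure set (measurableTypeR R) -> \bar R} :=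
  @lebesgue_measure R.

Definition leb2 (R : realType) :
    {measure set (measurableTypeR R * measurableTypeR R) -> \bar R} :=
  (@lebesgue_measure R \x @lebesgue_measure R)%E.

(* All iterated directional derivatives of order at most [k] exist and are
   continuous; in finite dimension this is being of class C^k. *)
Fixpoint class_C {R : realType} {V : normedModType R} (k : nat)
    (f : V -> R) : Prop :=
  match k with
  | 0 => continuous f
  | k'.+1 => continuous f /\
      forall v : V, (forall x, derivable f x v) /\ class_C k' ('D_v f)
  end.

Definition test_function {R : realType} {V : normedModType R}
    (phi : V -> R) : Prop :=
  (forall k, class_C k phi) /\ compact (closure [set x | phi x != 0]).

Definition weak_derivative {R : realType} (f df : R -> R) : Prop :=
  forall phi : R -> R, test_function phi ->
    (\int[leb1 R]_s (f s * 'D_1 phi s)%:E =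
     - \int[leb1 R]_s (df s * phi s)%:E)%E.

Definition weak_gradient {R : realType} (u : R * R -> R) (du : R * R -> R * R)
    : Prop :=
  forall phi : R * R -> R, test_function phi ->
    (\int[leb2 R]_x (u x * 'D_(1, 0) phi x)%:E =
     - \int[leb2 R]_x ((du x).1 * phi x)%:E)%E /\
    (\int[leb2 R]_x (u x * 'D_(0, 1) phi x)%:E =
     - \int[leb2 R]_x ((du x).2 * phi x)%:E)%E.

(* [u] is in H^1(R^2) and its distributional gradient is (a.e.) [du]. *)
Definition H1_gradient {R : realType} (u : R * R -> R) (du : R * R -> R * R)
    : Prop :=
  [/\ u \in Lfun (leb2 R) 2%:E,
      fst \o du \in Lfun (leb2 R) 2%:E,
      snd \o du \in Lfun (leb2 R) 2%:E &
      weak_gradient u du].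

Definition H1_norm_sqr {R : realType} (u : R * R -> R) (du : R * R -> R * R)
    : \bar R :=
  ('N[leb2 R]_(2%:E)[EFin \o u] ^+ 2 +
   'N[leb2 R]_(2%:E)[EFin \o (enorm \o du)] ^+ 2)%E.

Definition kappa (R : realType) : \bar R :=
  ereal_sup
    [set (\int[leb2 R]_x (expR (4 * pi * `|u x| ^+ 2) - 1)%:E)%E | u in
      [set u : R * R -> R |
        exists2 du, H1_gradient u du & (H1_norm_sqr u du <= 1)%E]].

(* Valued in [\bar R]: the infimum of the empty set is [+oo]. *)
Definition orlicz_norm {R : realType} (u : R * R -> R) : \bar R :=
  ereal_inf
    [set lambda%:E | lambda in
      [set lambda : R | 0 < lambda /\
        (\int[leb2 R]_x (expR (`|u x| ^+ 2 / lambda ^+ 2) - 1)%:E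
           <= kappa R)%E]].

Definition scale {R : realType} (alpha : nat -> R) : Prop :=
  (forall n, 0 < alpha n) /\ alpha n @[n --> \oo] --> +oo.

Definition orthogonal_scales {R : realType} (alpha beta : nat -> R) : Prop :=
  `|ln (beta n / alpha n)| @[n --> \oo] --> +oo.

(* Elements of the space of profiles are classes of functions modulo a.e.
   equality; [psi] stands for the continuous representative, whose pointwise
   values are used. *)
Definition profile {R : realType} (psi : R -> R) : Prop :=
  [/\ continuous psi,
      (leb1 R).-integrable setT (fun s => (psi s ^+ 2 * expR (- 2 * s))%:E),
      exists2 dpsi : R -> R,
        dpsi \in Lfun (leb1 R) 2%:E & weak_derivative psi dpsi &
      forall s, s <= 0 -> psi s = 0].

(* At [x = core] the library's [ln 0 = 0] makes the value [psi 0 = 0] for a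
   profile; a single point is negligible. *)
Definition concentration {R : realType} (alpha : R) (core : R * R)
    (psi : R -> R) (x : R * R) : R :=
  Num.sqrt (alpha / (2 * pi)) * psi (- ln (enorm (x - core)) / alpha).

Definition is_maximum {R : realType} (A : set R) (m : R) : Prop :=
  A m /\ ubound A m.

(* Main.v *)
Require Import Defs.
From HB Require Import structures.
From mathcomp Require Import all_boot all_order all_algebra.
From mathcomp Require Import all_classical all_reals all_analysis.
From mathcomp Require Import measurable_realfun ring lra.

Set Implicit Arguments.
Unset Strict Implicit.
Unset Printing Implicit Defensive.

Import Order.TTheory GRing.Theory Num.Theory.
Import numFieldNormedType.Exports.

Local Open Scope classical_set_scope.
Local Open Scope ring_scope.

(** Let [M_j] be the maximum of [|psi_j(s)| / sqrt s] over [s > 0] and [M] the largest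
    of the [M_j].  Written in the logarithmic distance [r = max(0, - log |x - x_n^j|)]
    to the core, the bound [|psi_j(s)| <= M_j sqrt s] reads
    [|g_n^j(x)| <= M_j sqrt (r / (2 pi))], independently of the scale, so that
    [exp (|g_n^j|^2 / lambda^2)] is at most the power [- M_j^2 / (2 pi lambda^2)] of the
    distance to the core.  That power is integrable near the core exactly when
    [M_j^2 < 4 pi lambda^2], and this is where the value [M_j / sqrt (4 pi)] comes from.

    The theorem is the statement that the superposition obeys the same threshold: the
    integral of [exp (|g_n|^2 / lambda^2) - 1] tends to [0] when [M^2 < 4 pi lambda^2]
    ([moser_small]) and to infinity when [M^2 > 4 pi lambda^2] ([moser_large]).  As
    [kappa] is finite by hypothesis and positive by [kappa_gt0], the norms converge to
    [M / sqrt (4 pi)] ([orlicz_norm_cvg]); a single concentrating profile is the case of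
    a family of length one.

    Superposing costs nothing because, at every point, at most one term is of the order
    of the square root of the largest logarithmic distance [rho] ([heights_decouple]).
    A profile is [o(sqrt s)] at [0] and at infinity, so the term of index [i] can only be
    of that order where [r_i] is comparable to its scale; for two indices with scales far
    apart, [r_i] and [r_j] are then far apart as well, and the term with the smaller of
    them is negligible in front of [sqrt rho].  The estimate holds for every family of
    numbers [r_i], hence uniformly in the positions of the cores.

    The facts on profiles rest on the estimate
    [|psi(t) - psi(s)| <= sqrt (t - s) * ||psi'||_{L^2(s, t)}]
    ([weak_derivative_holder]), which follows from the definition of the weak derivative
    by testing against smooth approximations of the indicator of [[s, t]].  It gives the
    behaviour of [psi / sqrt] at both ends of the half-line, hence the existence of the
    maximum ([profile_max]). *)

(** * Smooth functions of one variable *)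

Section SmoothFunctions.
Context {R : realType}.
Implicit Types f g : R -> R.

(** [class_C] quantifies over directional derivatives in all directions; on the
    line a single derivative carries the same information and is easier to
    propagate through products and compositions. *)
Fixpoint smooth_upto (k : nat) f : Prop :=
  match k with
  | 0 => continuous f
  | k'.+1 => exists2 f' : R -> R, (forall x, is_derive x (1 : R) f (f' x)) & smooth_upto k' f'
  end.

Lemma is_derive_continuous f (f' : R -> R) :
  (forall x, is_derive x (1 : R) f (f' x)) -> continuous f.
Proof.
move=> df x; apply: differentiable_continuous.
by apply/derivable1_diffP; case: (df x).
Qed.

Lemma smooth_upto_continuous k f : smooth_upto k f -> continuous f.
Proof. by case: k => [//|k] [f' df _]; exact: is_derive_continuous df. Qed.

Lemma smooth_upto_pred k f : smooth_upto k.+1 f -> smooth_upto k f.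
Proof.
elim: k f => [|k IH] f [f' df sf'].
  exact: is_derive_continuous df.
by exists f' => //; exact: IH.
Qed.

Lemma smooth_upto_add k f g : smooth_upto k f -> smooth_upto k g ->
  smooth_upto k (fun x => f x + g x).
Proof.
elim: k f g => [|k IH] f g /=.
  by move=> cf cg x; apply: cvgD; [exact: cf|exact: cg].
move=> [f' df sf] [g' dg sg]; exists (fun x => f' x + g' x); last exact: IH.
by move=> x; apply: is_deriveD.
Qed.

Lemma smooth_upto_scale k (c : R) f : smooth_upto k f ->
  smooth_upto k (fun x => c * f x).
Proof.
elim: k f => [|k IH] f /=.
  by move=> cf x; apply: cvgM; [exact: cvg_cst|exact: cf].
move=> [f' df sf]; exists (fun x => c * f' x); last exact: IH.
by move=> x; apply: is_deriveZ.
Qed.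

Lemma smooth_upto_mul k f g : smooth_upto k f -> smooth_upto k g ->
  smooth_upto k (fun x => f x * g x).
Proof.
elim: k f g => [|k IH] f g.
  by move=> cf cg x; apply: cvgM; [exact: cf|exact: cg].
move=> /[dup] /smooth_upto_pred sf [f' df sf'].
move=> /[dup] /smooth_upto_pred sg [g' dg sg'].
exists (fun x => f x * g' x + g x * f' x).
  by move=> x; apply: is_deriveM.
by apply: smooth_upto_add; exact: IH.
Qed.

Lemma is_derive_affine f (f' : R -> R) (a c : R) :
  (forall x, is_derive x (1 : R) f (f' x)) ->
  forall x, is_derive x (1 : R) (fun y => f (a * y + c)) (a * f' (a * x + c)).
Proof.
move=> df x; rewrite mulrC; apply: (@is_derive1_comp _ f (fun y => a * y + c)).
have da : is_derive x (1 : R) (a \*: id) (a *: 1) by apply: is_deriveZ.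
have := is_deriveD da (is_derive_cst c x 1).
by rewrite addr0 /GRing.scale /= mulr1.
Qed.

Lemma continuous_affine_comp f (a c : R) : continuous f ->
  continuous (fun x => f (a * x + c)).
Proof.
move=> cf x; apply: (@continuous_comp _ _ _ (fun x => a * x + c) f); last exact: cf.
by apply: (@is_derive_continuous (fun x => a * x + c)) => y;
  exact: is_derive_affine (is_derive_id^~ 1) y.
Qed.

Lemma smooth_upto_affine k f (a c : R) : smooth_upto k f ->
  smooth_upto k (fun x => f (a * x + c)).
Proof.
elim: k f => [|k IH] f; first exact: continuous_affine_comp.
move=> [f' df sf]; exists (fun x => a * f' (a * x + c)).
  exact: is_derive_affine.
by apply: smooth_upto_scale; exact: IH.
Qed.

Lemma smooth_upto_class_C k f : smooth_upto k f -> class_C k f.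
Proof.
elim: k f => [//|k IH] f sf; split; first exact: smooth_upto_continuous sf.
case: sf => f' df sf v.
have dv x : is_derive x v f (v * f' x).
  have [dfx vfx] := df x.
  have dif : differentiable f x by apply/derivable1_diffP.
  split; first exact: diff_derivable.
  by rewrite deriveE // -[v]mulr1 linearZ /= -deriveE// vfx mulr1.
split; first by move=> x; case: (dv x).
rewrite (_ : 'D_v f = fun x => v * f' x).
  by apply: IH; exact: smooth_upto_scale.
by apply/funext => x; case: (dv x).
Qed.

(** [x^-k * exp (- 1 / x)], extended by [0] to [x <= 0]: the family is closed
    under derivation up to linear combinations, which makes each of its members
    smooth without any explicit formula for the higher derivatives. *)
Definition expinv (k : nat) (x : R) : R :=
  if 0 < x then x^-1 ^+ k * expR (- x^-1) else 0.

Lemma expinv_ge0 k x : 0 <= expinv k x.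
Proof.
rewrite /expinv; case: ifPn => // x0.
by rewrite mulr_ge0 ?expR_ge0// exprn_ge0// invr_ge0 ltW.
Qed.

Lemma expinv_gt0 k x : 0 < x -> 0 < expinv k x.
Proof. by move=> x0; rewrite /expinv x0 mulr_gt0 ?expR_gt0// exprn_gt0// invr_gt0. Qed.

Lemma expinv_le0 k x : x <= 0 -> expinv k x = 0.
Proof. by rewrite /expinv ltNge => ->. Qed.

Lemma expinv_le_sqr k x : expinv k x <= k.+2`!%:R * x ^+ 2.
Proof.
rewrite /expinv; case: ifPn => x0; last by rewrite mulr_ge0 ?sqr_ge0.
have ui : 0 <= x^-1 by rewrite invr_ge0 ltW.
have := expR_ge1Dxn k.+1 ui => h.
have {}h : x^-1 ^+ k.+2 / k.+2`!%:R <= expR x^-1.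
  by apply: le_trans h; rewrite lerDr.
rewrite ler_pdivrMr ?ltr0n ?fact_gt0// in h.
rewrite expRN ler_pdivrMr ?expR_gt0//.
have -> : x^-1 ^+ k = x^-1 ^+ k.+2 * x ^+ 2.
  by rewrite -addn2 exprD -mulrA -exprMn mulVf ?gt_eqF// expr1n mulr1.
apply: (le_trans (ler_wpM2r (sqr_ge0 x) h)).
by rewrite le_eqVlt; apply/orP; left; apply/eqP; ring.
Qed.

(** Handles the junction point of the functions below, where the difference
    quotient is at most [C * `|x|]. *)
Lemma is_derive_sqr_bound f (C : R) : (forall x, `|f x| <= C * x ^+ 2) ->
  is_derive (0 : R) 1 f 0.
Proof.
move=> fC; have f0 : f 0 = 0.
  by apply/eqP; rewrite -normr_le0 (le_trans (fC _))// expr0n mulr0.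
apply/is_derive1_caratheodory; exists (fun z => f z / z); split.
- move=> z; rewrite f0 !subr0; have [->|z0] := eqVneq z 0.
    by rewrite f0 invr0 !mulr0.
  by rewrite divfK.
- rewrite /prop_for /continuous_at f0 mul0r.
  apply/cvgr0Pnorm_lt => e e0.
  have C1 : 0 < `|C| + 1 by rewrite ltr_wpDl.
  near=> z.
  have [->|z0] := eqVneq z 0; first by rewrite f0 mul0r normr0.
  rewrite normrM normfV ltr_pdivrMr ?normr_gt0//.
  apply: (le_lt_trans (fC z)).
  have zs : `|z| < e / (`|C| + 1).
    near: z; have := @nbhs0_lt _ R (e / (`|C| + 1)).
    by apply; rewrite divr_gt0.
  rewrite ltr_pdivlMr// in zs.
  have -> : z ^+ 2 = `|z| * `|z| by rewrite -normrM -expr2 ger0_norm// sqr_ge0.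
  rewrite mulrA ltr_pM2r ?normr_gt0//.
  apply: le_lt_trans zs; rewrite mulrC ler_wpM2l//.
  by rewrite (le_trans (ler_norm C))// lerDl.
- by rewrite f0 mul0r.
Unshelve. all: by end_near. Qed.

Lemma is_derive_expinv k x :
  is_derive x (1 : R) (expinv k) (expinv k.+2 x - k%:R * expinv k.+1 x).
Proof.
have [x0|x0|->] := ltgtP x 0.
- have E j : expinv j x = 0 by apply: expinv_le0; exact: ltW.
  rewrite !E mulr0 subrr.
  apply: near_eq_is_derive (is_derive_cst (0 : R) x 1).
  near=> y; rewrite expinv_le0//; apply: ltW.
  by near: y; exact: lt_nbhsl.
- have xn0 : x != 0 by rewrite gt_eqF.
  have dV : is_derive x (1 : R) (fun y => y^-1) (- x ^- 2 *: 1) by apply: is_deriveV.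
  have dVN := @is_deriveN _ _ _ _ x 1 _ dV.
  have dE := @is_derive1_comp _ expR _ x _ _ (is_derive_expR _) dVN.
  have dX := @is_deriveX _ _ _ k x 1 _ dV.
  have dM := is_deriveM dX dE.
  have E y : 0 < y -> expinv k y = y^-1 ^+ k * expR (- y^-1).
    by rewrite /expinv => ->.
  apply: is_derive_eq.
    apply: near_eq_is_derive dM.
    near=> y; rewrite E; first by rewrite !fctE.
    by near: y; exact: lt_nbhsr.
  rewrite /expinv x0 /GRing.scale /=.
  case: k dX dM E => [|k] dX dM E /=.
    by rewrite !fctE /=; field.
  by rewrite !fctE /= !exprS; field.
- have E j : expinv j (0 : R) = 0 by exact: expinv_le0.
  rewrite !E mulr0 subrr.
  apply: (@is_derive_sqr_bound _ k.+2`!%:R) => y.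
  by rewrite ger0_norm ?expinv_ge0// expinv_le_sqr.
Unshelve. all: by end_near. Qed.

Lemma smooth_expinv m k : smooth_upto m (expinv k).
Proof.
elim: m k => [|m IH] k.
  exact: is_derive_continuous (@is_derive_expinv k).
exists (fun x => expinv k.+2 x + - k%:R * expinv k.+1 x).
  by move=> x; rewrite mulNr; exact: is_derive_expinv.
by apply: smooth_upto_add => //; exact: smooth_upto_scale.
Qed.

Definition bump (x : R) : R := expinv 0 x * expinv 0 (1 - x).

Lemma smooth_bump m : smooth_upto m bump.
Proof.
apply: smooth_upto_mul; first exact: smooth_expinv.
have := @smooth_upto_affine m _ (-1) 1 (smooth_expinv m 0).
by congr smooth_upto; apply/funext => x; rewrite mulN1r addrC.
Qed.

Lemma bump_ge0 x : 0 <= bump x.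
Proof. by rewrite mulr_ge0 ?expinv_ge0. Qed.

Lemma bump_gt0 x : 0 < x < 1 -> 0 < bump x.
Proof. by move=> /andP[x0 x1]; rewrite mulr_gt0 ?expinv_gt0// subr_gt0. Qed.

Lemma bump_out x : x <= 0 \/ 1 <= x -> bump x = 0.
Proof.
move=> [x0|x1]; rewrite /bump; first by rewrite (expinv_le0 _ x0) mul0r.
by rewrite (@expinv_le0 _ (1 - x)) ?mulr0// subr_le0.
Qed.

End SmoothFunctions.

(** * The modulus of continuity of a function with square-integrable derivative *)

Section Calculus.
Context {R : realType}.
Implicit Types f F : R -> R.
Local Notation mu := (@lebesgue_measure R).

Lemma continuous_integrable_segment f a b : continuous f ->
  mu.-integrable `[a, b] (EFin \o f).
Proof.
move=> cf; apply: continuous_compact_integrable; first exact: segment_compact.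
exact: continuous_subspaceT.
Qed.

Lemma is_derive_derivable_oo F f a b :
  (forall x, is_derive x (1 : R) F (f x)) -> derivable_oo_LRcontinuous F a b.
Proof.
move=> dF; have cF := is_derive_continuous dF.
split; first by move=> x _; case: (dF x).
  by apply: cvg_at_right_filter; exact: cF.
by apply: cvg_at_left_filter; exact: cF.
Qed.

Lemma is_derive_derive1 F f : (forall x, is_derive x (1 : R) F (f x)) ->
  derive1 F =1 f.
Proof. by move=> dF x; rewrite derive1E; case: (dF x). Qed.

Lemma Rintegral_derive F f a b : a < b ->
  (forall x, is_derive x (1 : R) F (f x)) -> continuous f ->
  \int[mu]_(x in `[a, b]) f x = F b - F a.
Proof.
move=> ab dF cf; rewrite /Rintegral (@continuous_FTC2 _ f F a b)//.
- exact: continuous_subspaceT.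
- exact: is_derive_derivable_oo dF.
- by move=> x _; rewrite (is_derive_derive1 dF).
Qed.

Lemma ler_Rintegral_segment f g a b : continuous f -> continuous g ->
  (forall x, a <= x <= b -> f x <= g x) ->
  \int[mu]_(x in `[a, b]) f x <= \int[mu]_(x in `[a, b]) g x.
Proof.
by move=> cf cg fg; apply: le_Rintegral => //; exact: continuous_integrable_segment.
Qed.

Let step x := \int[mu]_(t in `[-1, x]) bump t.

Let continuous_bump : continuous (@bump R).
Proof. exact: (smooth_upto_continuous (smooth_bump 0)). Qed.

Let step_le0 x : x <= 0 -> step x = 0.
Proof.
move=> x0; rewrite /step; under eq_Rintegral => t.
  rewrite inE/= in_itv/= => /andP[_ tx]; rewrite bump_out; last first.
    by left; exact: le_trans x0.
  over.
by rewrite Rintegral_cst// mul0r.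
Qed.

Let is_derive_step x : is_derive x (1 : R) step (bump x).
Proof.
have [x0|x0] := ltP x 0.
  rewrite bump_out; last by left; exact: ltW.
  apply: near_eq_is_derive (is_derive_cst (0 : R) x 1).
  by near=> y; rewrite step_le0//; apply: ltW; near: y; exact: lt_nbhsl.
have x1 : x < x + 1 by rewrite ltrDl.
have x2 : -1 < x by rewrite (lt_le_trans _ x0)// ltrN10.
have ib := continuous_integrable_segment (-1) (x + 1) continuous_bump.
have [d1 d2] := @continuous_FTC1_closed R bump (-1) x (x + 1) x1 ib x2 (@continuous_bump x).
split; first exact: d1.
by rewrite -derive1E; exact: d2.
Unshelve. all: by end_near. Qed.

Let step_mono x y : x <= y -> step x <= step y.
Proof.
rewrite le_eqVlt => /predU1P[->//|xy]; rewrite -subr_ge0.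
rewrite -(Rintegral_derive xy is_derive_step continuous_bump).
by apply: Rintegral_ge0 => t _; exact: bump_ge0.
Qed.

Let step_ge1 x : 1 <= x -> step x = step 1.
Proof.
rewrite le_eqVlt => /predU1P[<-//|x1]; apply/eqP; rewrite -subr_eq0.
rewrite -(Rintegral_derive x1 is_derive_step continuous_bump).
under eq_Rintegral => t.
  rewrite inE/= in_itv/= => /andP[t1 _]; rewrite bump_out; last by right.
  over.
by rewrite Rintegral_cst// mul0r.
Qed.

Let step1_gt0 : 0 < step 1.
Proof.
have [|c c01] := @MVT _ step bump 0 1 ltr01 (fun x _ => is_derive_step x).
  by apply: continuous_subspaceT; exact: is_derive_continuous is_derive_step.
rewrite (step_le0 (lexx 0)) !subr0 mulr1 => ->.
by apply: bump_gt0; rewrite in_itv in c01.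
Qed.

(** The normalized primitive of the bump.  Differences of its rescaled translates
    are test functions that approximate indicators of intervals. *)
Lemma smooth_transition : exists S sigma : R -> R,
  [/\ forall k, smooth_upto k S, {homo S : x y / x <= y},
      forall x, x <= 0 -> S x = 0 & forall x, 1 <= x -> S x = 1] /\
  [/\ forall x, is_derive x (1 : R) S (sigma x), continuous sigma,
      forall x, 0 <= sigma x & forall x, x <= 0 \/ 1 <= x -> sigma x = 0].
Proof.
have dS x : is_derive x (1 : R) (fun x => (step 1)^-1 * step x) ((step 1)^-1 * bump x).
  by apply: is_deriveZ.
exists (fun x => (step 1)^-1 * step x), (fun x => (step 1)^-1 * bump x).
split; split => //.
- move=> k; apply: smooth_upto_scale; apply: smooth_upto_pred.
  by exists (@bump R); [exact: is_derive_step|exact: smooth_bump].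
- by move=> x y xy; rewrite ler_pM2l ?invr_gt0//; exact: step_mono.
- by move=> x x0; rewrite (step_le0 x0) mulr0.
- by move=> x x1; rewrite (step_ge1 x1) mulVf// gt_eqF.
- exact: (smooth_upto_continuous (smooth_upto_scale _ (smooth_bump 0))).
- by move=> x; rewrite mulr_ge0 ?bump_ge0// invr_ge0 ltW.
- by move=> x x01; rewrite bump_out// mulr0.
Qed.

End Calculus.

Section WeakDerivative.
Context {R : realType}.
Implicit Types f df : R -> R.
Local Notation mu := (@lebesgue_measure R).

Lemma Rintegral_supported d (T : measurableType d) (m : {measure set T -> \bar R})
    (D : set T) (g : T -> R) :
  (forall x, ~ D x -> g x = 0) -> \int[m]_x g x = \int[m]_(x in D) g x.
Proof.
move=> g0; rewrite [RHS]Rintegral_mkcond; congr (Rintegral _ _ _).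
apply/funext => x; rewrite patchE; case: ifPn => // /negP xD.
by apply: g0 => Dx; apply: xD; rewrite inE.
Qed.

(** The rescaled [sigma] is nonnegative, has integral [S 1 - S 0 = 1] and lives on
    [[a, a + e]]: integrating [f] against it is averaging values close to [q]. *)
Lemma approximate_dirac (sigma S f : R -> R) (s t a e q dl : R) :
  (forall x, is_derive x (1 : R) S (sigma x)) -> continuous sigma ->
  (forall x, x <= 0 -> S x = 0) -> (forall x, 1 <= x -> S x = 1) ->
  (forall x, 0 <= sigma x) -> (forall x, x <= 0 \/ 1 <= x -> sigma x = 0) ->
  continuous f -> s < t -> 0 < e -> s <= a -> a + e <= t ->
  (forall x, a <= x <= a + e -> `|f x - q| <= dl) ->
  `|\int[mu]_(x in `[s, t]) (f x * (e^-1 * sigma (e^-1 * x + - (a / e)))) - q| <= dl.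
Proof.
move=> dS cs S0 S1 sg0 sgo cf st e0 sa aet fq.
have ei : 0 < e^-1 by rewrite invr_gt0.
set w := fun x => e^-1 * sigma (e^-1 * x + - (a / e)).
have cw : continuous w.
  move=> x; apply: cvgM; first exact: cvg_cst.
  exact: continuous_affine_comp.
have w0 x : 0 <= w x by rewrite mulr_ge0// ltW.
have w1 : \int[mu]_(x in `[s, t]) w x = 1.
  rewrite (Rintegral_derive st (is_derive_affine e^-1 (- (a / e)) dS) cw).
  rewrite S1 ?S0 ?subr0//.
    by rewrite mulrC -mulrBl pmulr_lle0// subr_le0.
  by rewrite mulrC -mulrBl ler_pdivlMr// mul1r; lra.
have wo x : ~ (a <= x <= a + e) -> w x = 0.
  move=> xa; rewrite /w sgo ?mulr0// mulrC -mulrBl.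
  have [xa'|ax] := ltP x a; first by left; rewrite pmulr_lle0// subr_le0 ltW.
  right; rewrite ler_pdivlMr// mul1r.
  have [xe|] := leP x (a + e); last by lra.
  by exfalso; apply: xa; rewrite ax.
have cfw : continuous (fun x => f x * w x).
  by move=> x; apply: cvgM; [exact: cf|exact: cw].
have wk k : \int[mu]_(x in `[s, t]) (k * w x) = k.
  rewrite RintegralZl ?w1 ?mulr1//; exact: continuous_integrable_segment.
have ckw k : continuous (fun x => k * w x).
  by move=> x; apply: cvgM; [exact: cvg_cst|exact: cw].
rewrite ler_distl; apply/andP; split.
  rewrite -[leLHS]wk; apply: ler_Rintegral_segment => // x _; rewrite -/(w x).
  have [xa|xa] := pselect (a <= x <= a + e); last by rewrite wo// !mulr0.
  by rewrite ler_wpM2r//; have := fq x xa; rewrite ler_distl => /andP[].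
rewrite -[leRHS]wk; apply: ler_Rintegral_segment => // x _; rewrite -/(w x).
have [xa|xa] := pselect (a <= x <= a + e); last by rewrite wo// !mulr0.
by rewrite ler_wpM2r//; have := fq x xa; rewrite ler_distl => /andP[].
Qed.

Lemma test_functionP (phi : R -> R) (s t : R) : (forall k, smooth_upto k phi) ->
  (forall x, ~ (s <= x <= t) -> phi x = 0) -> test_function phi.
Proof.
move=> sphi phi0; split; first by move=> k; exact: smooth_upto_class_C.
apply: (@subclosed_compact _ _ `[s, t]%classic).
- exact: closed_closure.
- exact: segment_compact.
- have -> : `[s, t]%classic = closure `[s, t]%classic.
    by apply/closure_id; exact: interval_closed.
  apply: closure_subset => x /=; rewrite in_itv/= => px.
  by have [//|/phi0 p0] := pselect (s <= x <= t); rewrite p0 eqxx in px.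
Qed.

(** Tested against smoothed indicators of [[s, t]], the weak derivative returns
    [f t - f s] up to averages of [f] near the endpoints.  The Cauchy-Schwarz bound
    is kept in the linearized form with a free parameter [c]. *)
Lemma weak_derivative_increment f df (s t c : R) : continuous f ->
  df \in Lfun (leb1 R) 2%:E -> weak_derivative f df -> s < t -> 0 < c ->
  `|f t - f s| <=
    (c * (\int[leb1 R]_(x in `[s, t]) (df x ^+ 2)) + c^-1 * (t - s)) / 2.
Proof.
move=> cf ldf wdf st c0.
have idf2 : mu.-integrable [set: R] (EFin \o (fun x => df x ^+ 2)).
  exact: Lfun2_integrable_sqr ldf.
have mdf : measurable_fun [set: R] df.
  by move: ldf; rewrite inE => /andP[]; rewrite inE.
apply/ler_addgt0Pr => dl dl0.
have dl2 : 0 < dl / 2 by rewrite divr_gt0.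
(* [e] is the width of the two transitions, and a modulus of continuity at [s]
   and [t]. *)
have [e [e0 est fs ft]] : exists e, [/\ 0 < e, e < t - s,
    forall x, `|x - s| <= e -> `|f x - f s| <= dl / 2 &
    forall x, `|x - t| <= e -> `|f x - f t| <= dl / 2].
  have ex a : exists2 r, 0 < r & forall x, `|x - a| < r -> `|f x - f a| <= dl / 2.
    have /cvgrPdist_le /(_ _ dl2) := cf a.
    move=> /nbhs_ballP[r /= r0 h]; exists r => // x xr.
    by rewrite distrC; apply: h; rewrite /ball/= distrC.
  have [r1 r10 h1] := ex s; have [r2 r20 h2] := ex t.
  exists (Num.min (t - s) (Num.min r1 r2) / 2).
  have m0 : 0 < Num.min (t - s) (Num.min r1 r2).
    by rewrite !lt_min subr_gt0 st r10.
  have mlt : Num.min (t - s) (Num.min r1 r2) / 2 < Num.min (t - s) (Num.min r1 r2).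
    by rewrite ltr_pdivrMr// mulr2n mulrDr mulr1 ltrDl.
  have := mlt; rewrite !lt_min => /and3P[q1 q2 q3].
  split => //; first by rewrite divr_gt0.
    by move=> x xs; apply: h1; apply: le_lt_trans q2.
  by move=> x xs; apply: h2; apply: le_lt_trans q3.
have [S [sg [[sS Smon S0 S1] [dS csg sg0 sgo]]]] := @smooth_transition R.
(* [ph] climbs from [0] to [1] on [[s, s + e]] and back on [[t - e, t]]. *)
pose ph x := S (e^-1 * x + - (s / e)) - S (e^-1 * x + - ((t - e) / e)).
pose dph x := e^-1 * sg (e^-1 * x + - (s / e)) - e^-1 * sg (e^-1 * x + - ((t - e) / e)).
have ei : 0 < e^-1 by rewrite invr_gt0.
have dphE x : is_derive x (1 : R) ph (dph x).
  apply: is_deriveB; exact: (is_derive_affine e^-1 _ dS).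
have arg_le x a : x <= a -> e^-1 * x + - (a / e) <= 0.
  by move=> xa; rewrite mulrC -mulrBl pmulr_lle0// subr_le0.
have arg_ge x a : a + e <= x -> 1 <= e^-1 * x + - (a / e).
  by move=> xa; rewrite mulrC -mulrBl ler_pdivlMr// mul1r; lra.
have out x : ~ (s <= x <= t) -> ph x = 0 /\ dph x = 0.
  move=> xst; have [xs|sx] := ltP x s.
    rewrite /ph /dph !S0 ?sgo ?mulr0 ?subrr//; try left; apply: arg_le; lra.
  have tx : t < x by rewrite ltNge; apply/negP => xt; apply: xst; rewrite sx.
  rewrite /ph /dph !S1 ?sgo ?mulr0 ?subrr//; try right; apply: arg_ge; lra.
have S01 x : 0 <= S x <= 1.
  have [x0|x0] := leP x 0; first by rewrite S0// lexx ler01.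
  have [x1|x1] := leP 1 x; first by rewrite S1// lexx ler01.
  by rewrite -{1}(S0 0 (lexx 0)) -(S1 1 (lexx 1)) !Smon// ltW.
have ph1 x : `|ph x| <= 1.
  have /andP[u0 u1] := S01 (e^-1 * x + - (s / e)).
  have /andP[v0 v1] := S01 (e^-1 * x + - ((t - e) / e)).
  by rewrite /ph ler_norml; apply/andP; split; lra.
have cph : continuous ph := is_derive_continuous dphE.
have sph k : smooth_upto k ph.
  rewrite /ph -[X in smooth_upto k X]/(fun x => S (e^-1 * x + - (s / e))
    - S (e^-1 * x + - ((t - e) / e))).
  have := smooth_upto_add (smooth_upto_affine e^-1 (- (s / e)) (sS k))
    (smooth_upto_scale (-1) (smooth_upto_affine e^-1 (- ((t - e) / e)) (sS k))).
  by congr smooth_upto; apply/funext => x; rewrite mulN1r.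
have tph : test_function ph.
  by apply: (test_functionP sph (s := s) (t := t)) => x /out[].
(* Young's inequality [`|df| <= h] takes the place of Cauchy-Schwarz. *)
pose h x := (c * df x ^+ 2 + c^-1) / 2.
have dfh x : `|df x * ph x| <= h x.
  rewrite normrM; apply: (@le_trans _ _ (`|df x| * 1)).
    by rewrite ler_wpM2l.
  rewrite mulr1 /h ler_pdivlMr//.
  have c1 : c * c^-1 = 1 by rewrite mulfV// gt_eqF.
  have ci : 0 < c^-1 by rewrite invr_gt0.
  have : 0 <= c * (`|df x| - c^-1) ^+ 2 by rewrite mulr_ge0 ?sqr_ge0// ltW.
  rewrite sqrrB real_normK ?num_real// => H.
  suff : c * (df x ^+ 2 - `|df x| * c^-1 *+ 2 + c^-1 ^+ 2) =
     c * df x ^+ 2 - `|df x| * (c * c^-1) *+ 2 + (c * c^-1) * c^-1.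
    by rewrite c1 mulr1 mul1r => E; rewrite E in H; rewrite mulr_natr; lra.
  by ring.
have ses : s + e <= t by lra.
have ste : s <= t - e by lra.
have tee : t - e + e <= t by lra.
have nears x : s <= x <= s + e -> `|f x - f s| <= dl / 2.
  by move=> /andP[x1 x2]; apply: fs; rewrite ger0_norm; lra.
have neart x : t - e <= x <= t - e + e -> `|f x - f t| <= dl / 2.
  by move=> /andP[x1 x2]; apply: ft; rewrite ler0_norm; lra.
have wint : \int[mu]_(x in `[s, t]) (f x * dph x) =
    - \int[mu]_(x in `[s, t]) (df x * ph x).
  rewrite -(@Rintegral_supported _ _ mu _ (fun x => f x * dph x)); last first.
    by move=> x; rewrite /= in_itv/= => /out[_ ->]; rewrite mulr0.
  rewrite -(@Rintegral_supported _ _ mu _ (fun x => df x * ph x)); last first.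
    by move=> x; rewrite /= in_itv/= => /out[-> _]; rewrite mulr0.
  rewrite /Rintegral -fineN; congr fine.
  have := wdf ph tph; rewrite /leb1 => <-.
  by apply: eq_integral => x _; case: (dphE x) => _ <-.
have fdph : \int[mu]_(x in `[s, t]) (f x * dph x) =
    \int[mu]_(x in `[s, t]) (f x * (e^-1 * sg (e^-1 * x + - (s / e)))) -
    \int[mu]_(x in `[s, t]) (f x * (e^-1 * sg (e^-1 * x + - ((t - e) / e)))).
  rewrite -RintegralB//; last 2 first.
  - apply: continuous_integrable_segment => x.
    apply: cvgM; first exact: cf.
    apply: cvgM; first exact: cvg_cst.
    exact: continuous_affine_comp.
  - apply: continuous_integrable_segment => x.
    apply: cvgM; first exact: cf.
    apply: cvgM; first exact: cvg_cst.
    exact: continuous_affine_comp.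
  by apply: eq_Rintegral => x _; rewrite /dph mulrBr.
have hs : `|\int[mu]_(x in `[s, t]) (f x * (e^-1 * sg (e^-1 * x + - (s / e)))) - f s| <= dl / 2.
  exact: (approximate_dirac dS).
have ht : `|\int[mu]_(x in `[s, t])
    (f x * (e^-1 * sg (e^-1 * x + - ((t - e) / e)))) - f t| <= dl / 2.
  exact: (approximate_dirac dS).
have mst : measurable (`[s, t]%classic : set (measurableTypeR R)) by [].
have idf2s : mu.-integrable `[s, t] (EFin \o (fun x => df x ^+ 2)).
  exact: integrableS idf2.
have icst k : mu.-integrable `[s, t] (EFin \o (fun=> k : R)).
  by apply: continuous_integrable_segment => x; exact: cvg_cst.
have icdf : mu.-integrable `[s, t] (EFin \o (fun x => c * df x ^+ 2)).
  rewrite (_ : EFin \o _ = (fun x => (c%:E * (df x ^+ 2)%:E)%E)); first exact: integrableZl.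
  by apply/funext.
have ih0 : mu.-integrable `[s, t] (EFin \o (fun x => c * df x ^+ 2 + c^-1)).
  have := integrableD mst icdf (icst c^-1).
  by apply: eq_integrable.
have ih : mu.-integrable `[s, t] (EFin \o h).
  have := integrableZr mst 2^-1 ih0.
  by apply: eq_integrable.
have idfph : mu.-integrable `[s, t] (EFin \o (fun x => df x * ph x)).
  apply: le_integrable ih => //.
    apply/measurable_EFinP; apply: measurable_funM.
      exact: measurable_funTS.
    by apply: measurable_funTS; exact: continuous_measurable_fun.
  by move=> x _ /=; rewrite lee_fin (le_trans (dfh x))// ler_norm.
have bound : `|\int[mu]_(x in `[s, t]) (df x * ph x)| <=
    (c * (\int[leb1 R]_(x in `[s, t]) (df x ^+ 2)) + c^-1 * (t - s)) / 2.
  apply: (@le_trans _ _ (\int[mu]_(x in `[s, t]) `|df x * ph x|)).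
    exact: le_normr_Rintegral.
  apply: (@le_trans _ _ (\int[mu]_(x in `[s, t]) h x)).
    apply: le_Rintegral => //.
    exact: integrable_norm.
  rewrite /h RintegralZr//.
  rewrite RintegralD//.
  rewrite RintegralZl// Rintegral_cst//.
  have -> // : fine (mu `[s, t]) = t - s.
  by have := @lebesgue_measure_itv R `[s, t]; rewrite /= lte_fin st => ->.
move: hs ht; rewrite distrC (distrC (Rintegral _ _ _)) => hs ht.
move: bound; rewrite -normrN -wint fdph => bound.
set I1 := Rintegral _ _ _ in hs bound; set I2 := Rintegral _ _ _ in ht bound.
have -> : f t - f s = (f t - I2) - (f s - I1) - (I1 - I2) by ring.
apply: (le_trans (ler_normB _ _)).
rewrite addrC; apply: lerD => //.
apply: (le_trans (ler_normB _ _)).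
by rewrite [leRHS](splitr dl) lerD.
Qed.

End WeakDerivative.

(** * Profiles compared with the square root *)

Section Profiles.
Context {R : realType}.
Implicit Types psi : R -> R.

Lemma weak_derivative_holder (f df : R -> R) (s t eta : R) : continuous f ->
  df \in Lfun (leb1 R) 2%:E -> weak_derivative f df -> s < t -> 0 < eta ->
  \int[leb1 R]_(x in `[s, t]) (df x ^+ 2) <= eta ^+ 2 ->
  `|f t - f s| <= eta * Num.sqrt (t - s).
Proof.
move=> cf ldf wdf st eta0 E.
have ts : 0 < t - s by rewrite subr_gt0.
have q0 : 0 < Num.sqrt (t - s) by rewrite sqrtr_gt0.
(* [c] balances the two terms of the bound. *)
have c0 : 0 < Num.sqrt (t - s) / eta by rewrite divr_gt0.
apply: (le_trans (weak_derivative_increment cf ldf wdf st c0)).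
rewrite ler_pdivrMr//.
have -> : eta * Num.sqrt (t - s) * 2 =
    Num.sqrt (t - s) / eta * eta ^+ 2 + (Num.sqrt (t - s) / eta)^-1 * (t - s).
  rewrite -{4}(sqr_sqrtr (ltW ts)); field.
  by rewrite !gt_eqF.
by apply: lerD => //; rewrite ler_pM2l.
Qed.

Lemma profile_continuous psi : profile psi -> continuous psi.
Proof. by case. Qed.

Lemma profile0 psi s : profile psi -> s <= 0 -> psi s = 0.
Proof. by case=> _ _ _; apply. Qed.

Let sqr_integral (df : R -> R) s t := \int[leb1 R]_(x in `[s, t]) (df x ^+ 2).

(** The energy of [psi] on [[0, s]] tends to [0] with [s]. *)
Lemma profile_near0 psi (eta : R) : profile psi -> 0 < eta ->
  exists2 a, 0 < a & forall s, 0 <= s <= a -> `|psi s| <= eta * Num.sqrt s.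
Proof.
move=> ppsi eta0; case: (ppsi) => cpsi _ [df ldf wdf] psi0.
have idf2 := Lfun2_integrable_sqr ldf.
have [d [d0 dint]] := integral_normr_continuous idf2 (exprn_gt0 2 eta0).
exists (d / 2); first by rewrite divr_gt0.
move=> s /andP[]; rewrite le_eqVlt => /predU1P[<- _|s0 sd].
  by rewrite psi0// normr0 sqrtr0 mulr0.
have := @weak_derivative_holder psi df 0 s eta cpsi ldf wdf s0 eta0.
rewrite (psi0 0 (lexx 0)) !subr0; apply.
have ms : (leb1 R `[0%R, s]%classic < d%:E)%E.
  have := @lebesgue_measure_itv R `[0, s]; rewrite /= lte_fin s0 /leb1 => ->.
  rewrite -EFinD lte_fin subr0 (le_lt_trans sd)//.
  by rewrite ltr_pdivrMr// mulr2n mulrDr mulr1 ltrDl.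
apply: ltW; apply: le_lt_trans (dint `[0, s]%classic (measurable_itv _) ms).
rewrite le_eqVlt; apply/orP; left; apply/eqP.
by apply: eq_Rintegral => x _; rewrite ger0_norm ?sqr_ge0.
Qed.

(** The energy of [psi] beyond [T] tends to [0] as [T] grows, and the contribution
    of [psi T] is negligible in front of the square root of [s]. *)
Lemma profile_tail psi (eta : R) : profile psi -> 0 < eta ->
  exists2 A, 0 < A & forall s, A <= s -> `|psi s| <= eta * Num.sqrt s.
Proof.
move=> ppsi eta0; case: (ppsi) => cpsi _ [df ldf wdf] psi0.
have idf2 := Lfun2_integrable_sqr ldf.
have h0 : 0 < eta / 2 by rewrite divr_gt0.
have iS s t : (leb1 R).-integrable `[s, t] (EFin \o (fun x => df x ^+ 2)).
  exact: integrableS idf2.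
have mono (B C : set (measurableTypeR R)) : measurable B -> measurable C ->
    B `<=` C -> \int[leb1 R]_(x in B) (df x ^+ 2) <= \int[leb1 R]_(x in C) (df x ^+ 2).
  move=> mB mC BC; rewrite /Rintegral fine_le//.
  - by apply: integrable_fin_num => //; exact: integrableS idf2.
  - by apply: integrable_fin_num => //; exact: integrableS idf2.
  apply: ge0_subset_integral => //.
    apply: (@measurable_int _ _ _ (leb1 R)); exact: integrableS idf2.
  by move=> x _; rewrite lee_fin sqr_ge0.
pose E := [set sqr_integral df 0 n%:R | n in [set: nat]].
have supE : has_sup E.
  split; first by exists (sqr_integral df 0 0%:R); exists 0%N.
  exists (\int[leb1 R]_x (df x ^+ 2)) => _ [n _ <-].
  exact: mono.
have [_ [N _ <-] supN] := sup_adherent (exprn_gt0 2 h0) supE.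
pose T : R := N%:R.
have tail s : T < s -> sqr_integral df T s <= (eta / 2) ^+ 2.
  move=> Ts; pose m := Num.Def.archi_bound s.
  have sm : s <= m%:R.
    by rewrite ltW// archi_boundP// (le_trans _ (ltW Ts))// ler0n.
  have Em : sqr_integral df 0 m%:R <= sup E by apply: ub_le_sup => //; [case: supE|exists m].
  apply: (@le_trans _ _ (sqr_integral df T m%:R)).
    by apply: mono => //; apply: subset_itvl; rewrite bnd_simp.
  rewrite /sqr_integral -Rintegral_itv_obnd_cbnd; last first.
    apply: integrableS idf2 => //.
  rewrite -(Rintegral_itvB (a := BLeft 0)); last 3 first.
  - exact: iS.
  - by rewrite bnd_simp ler0n.
  - by rewrite bnd_simp (le_trans (ltW Ts)).
  by rewrite lerBlDr; apply: (le_trans Em); rewrite -lerBlDl ltW.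
exists (Num.max (T + 1) ((2 * `|psi T| / eta) ^+ 2)).
  by rewrite lt_max ltr_wpDl.
move=> s; rewrite ge_max => /andP[Ts ps].
have {}Ts : T < s by rewrite (lt_le_trans _ Ts)// ltrDl.
have T0 : 0 <= T by rewrite ler0n.
have inc := weak_derivative_holder cpsi ldf wdf Ts h0 (tail s Ts).
have psT : `|psi T| <= eta / 2 * Num.sqrt s.
  have : 2 * `|psi T| / eta <= Num.sqrt s.
    have p0 : 0 <= 2 * `|psi T| / eta by rewrite divr_ge0// ?mulr_ge0// ltW.
    by rewrite -[leLHS](ger0_norm p0) -sqrtr_sqr ler_wsqrtr.
  by rewrite ler_pdivrMr// => H; lra.
have sq : Num.sqrt (s - T) <= Num.sqrt s by rewrite ler_wsqrtr// lerBlDr lerDl.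
have -> : psi s = (psi s - psi T) + psi T by rewrite subrK.
apply: (le_trans (ler_normD _ _)).
have : eta / 2 * Num.sqrt (s - T) <= eta / 2 * Num.sqrt s by rewrite ler_pM2l.
by move=> H; lra.
Qed.

(** The quotient of [psi] by the square root is continuous on the positive half-line
    and small at both ends: away from a compact interval it stays below its value
    at a point where [psi] does not vanish. *)
Lemma profile_max psi : profile psi ->
  exists m, is_maximum
    [set `|psi s| / Num.sqrt s | s in [set s : R | 0 < s]] m.
Proof.
move=> ppsi.
have [/existsNP[s1]|psi0] := pselect (~ forall s, 0 < s -> psi s = 0); last first.
  have {}psi0 s : 0 < s -> psi s = 0 by apply: contrapT psi0 s.
  exists 0; split; first by exists 1 => //=; rewrite psi0// normr0 mul0r.
  by move=> _ [s /= s0 <-]; rewrite psi0// normr0 mul0r.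
move=> /not_implyP[s10 /eqP psi1].
pose q := `|psi s1| / Num.sqrt s1.
have q0 : 0 < q by rewrite divr_gt0 ?sqrtr_gt0// normr_gt0.
have [a a0 ha] := profile_near0 ppsi q0.
have [A A0 hA] := profile_tail ppsi q0.
pose u := Num.min a s1; pose v := Num.max A s1.
have u0 : 0 < u by rewrite lt_min a0.
have uv : u <= v by apply: (@le_trans _ _ s1); rewrite ?ge_min ?le_max lexx orbT.
have cont : {within `[u, v], continuous (fun s => `|psi s| / Num.sqrt s)}.
  apply: continuous_in_subspaceT => x; rewrite inE/= in_itv/= => /andP[ux _].
  have x0 : 0 < x by rewrite (lt_le_trans u0).
  apply: cvgM.
    by apply: cvg_norm; exact: profile_continuous.
  apply: cvgV; first by rewrite gt_eqF// sqrtr_gt0.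
  exact: sqrt_continuous.
have [c cuv cmax] := EVT_max uv cont.
have c0 : 0 < c by move: cuv; rewrite in_itv/= => /andP[uc _]; rewrite (lt_le_trans u0).
have s1uv : s1 \in `[u, v].
  by rewrite in_itv/= /u /v ge_min le_max !lexx !orbT.
exists (`|psi c| / Num.sqrt c); split; first by exists c.
move=> _ [s /= s0 <-].
have [suv|] := boolP (s \in `[u, v]); first exact: cmax.
rewrite in_itv/= negb_and -!ltNge => suv.
apply: le_trans (cmax _ s1uv); rewrite -/q ler_pdivrMr ?sqrtr_gt0//.
case/orP: suv => [su|vs].
  by apply: ha; rewrite (ltW s0) ltW// (lt_le_trans su)// ge_min lexx.
by apply: hA; rewrite ltW// (le_lt_trans _ vs)// le_max lexx.
Qed.

Lemma profile_le_max psi m s : profile psi ->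
  is_maximum [set `|psi s| / Num.sqrt s | s in [set s : R | 0 < s]] m ->
  0 <= s -> `|psi s| <= m * Num.sqrt s.
Proof.
move=> ppsi [_ mub]; rewrite le_eqVlt => /predU1P[<-|s0].
  by rewrite (profile0 ppsi)// normr0 sqrtr0 mulr0.
by rewrite -ler_pdivrMr ?sqrtr_gt0//; apply: mub; exists s.
Qed.

Lemma profile_max_attained psi m :
  is_maximum [set `|psi s| / Num.sqrt s | s in [set s : R | 0 < s]] m ->
  exists2 s, 0 < s & `|psi s| = m * Num.sqrt s.
Proof.
move=> [[s /= s0 <-] _]; exists s => //.
by rewrite divfK// gt_eqF// sqrtr_gt0.
Qed.

Lemma profile_max_ge0 psi m :
  is_maximum [set `|psi s| / Num.sqrt s | s in [set s : R | 0 < s]] m -> 0 <= m.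
Proof. by move=> [[s /= s0 <-] _]; rewrite divr_ge0// sqrtr_ge0. Qed.

End Profiles.

(** * Profiles at orthogonal scales *)

Section Heights.
Context {R : realType}.
Implicit Types psi : R -> R.

(** Up to the factor [1 / sqrt (2 pi)], this is the absolute value of a concentrating
    profile at a point of logarithmic distance [r] to its core. *)
Definition height (a : R) psi (r : R) : R := Num.sqrt a * `|psi (r / a)|.

Lemma height_le psi (a c r : R) : 0 < a ->
  `|psi (r / a)| <= c * Num.sqrt (r / a) -> height a psi r <= c * Num.sqrt r.
Proof.
move=> a0 h; rewrite /height.
have sa : 0 < Num.sqrt a by rewrite sqrtr_gt0.
apply: (le_trans (ler_wpM2l (ltW sa) h)).
by rewrite mulrCA -sqrtrM ?(ltW a0)// [a * _]mulrC divfK ?gt_eqF.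
Qed.

Lemma height_le_max psi (a m r : R) : profile psi ->
  is_maximum [set `|psi s| / Num.sqrt s | s in [set s : R | 0 < s]] m ->
  0 < a -> 0 <= r -> height a psi r <= m * Num.sqrt r.
Proof.
move=> ppsi mm a0 r0; apply: height_le => //.
by apply: profile_le_max => //; rewrite divr_ge0// ltW.
Qed.

(** A height is of the order of the square root only where [r] is comparable to
    the scale.  When the scales are far apart and both heights are large, [r1]
    and [r2] are therefore far apart as well, and the height of the smaller of
    them is negligible in front of the square root of the larger. *)
Lemma heights_decouple psi1 psi2 (eta : R) : profile psi1 -> profile psi2 ->
  0 < eta -> exists2 B, 0 < B & forall a1 a2 r1 r2 rho, 0 < a1 -> 0 < a2 ->
    B * a1 <= a2 -> 0 <= r1 <= rho -> 0 <= r2 <= rho ->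
    height a1 psi1 r1 <= eta * Num.sqrt rho \/
    height a2 psi2 r2 <= eta * Num.sqrt rho.
Proof.
move=> p1 p2 eta0.
have [m mm] := profile_max p1.
have [A A0 hA] := profile_tail p1 eta0.
have [a a0 ha] := profile_near0 p2 eta0.
have m0 : 0 < m + 1 by rewrite ltr_wpDl// (profile_max_ge0 mm).
(* When [r1 <= tau * r2], the bound by [m * Num.sqrt r1] already suffices. *)
pose tau := (eta / (m + 1)) ^+ 2.
have tau0 : 0 < tau by rewrite exprn_gt0// divr_gt0.
have ta0 : 0 < tau * a by rewrite mulr_gt0.
exists (A / (tau * a)); first by rewrite divr_gt0.
move=> a1 a2 r1 r2 rho a10 a20 Ba /andP[r10 r1rho] /andP[r20 r2rho].
have s1 : Num.sqrt r1 <= Num.sqrt rho by rewrite ler_wsqrtr.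
have s2 : Num.sqrt r2 <= Num.sqrt rho by rewrite ler_wsqrtr.
have to_rho x : Num.sqrt x <= Num.sqrt rho -> eta * Num.sqrt x <= eta * Num.sqrt rho.
  by move=> ?; rewrite ler_pM2l.
have [r1r2|r2r1] := leP r1 (tau * r2).
  left; apply: (le_trans (height_le_max p1 mm a10 r10)).
  apply: (@le_trans _ _ (eta * Num.sqrt r2)); last exact: to_rho.
  apply: (@le_trans _ _ ((m + 1) * Num.sqrt (tau * r2))).
    apply: ler_pM; rewrite ?sqrtr_ge0 ?(profile_max_ge0 mm) ?lerDl//.
    by rewrite ler_wsqrtr.
  rewrite sqrtrM ?(ltW tau0)// sqrtr_sqr gtr0_norm ?divr_gt0//.
  by rewrite mulrA [(m + 1) * _]mulrC divfK ?gt_eqF.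
have [A1|r1A] := leP (A * a1) r1.
  left; apply: le_trans (to_rho _ s1); apply: height_le => //.
  by apply: hA; rewrite ler_pdivlMr.
right; apply: le_trans (to_rho _ s2); apply: height_le => //.
apply: ha; rewrite divr_ge0 ?(ltW a20)//= ler_pdivrMr//.
have h1 : tau * r2 <= A * a1 by rewrite ltW// (lt_trans r2r1).
have h2 : A * a1 <= a2 * (tau * a).
  by rewrite -ler_pdivrMr// mulrAC.
rewrite -(ler_pM2l tau0) (le_trans h1)// (le_trans h2)//.
by rewrite le_eqVlt; apply/orP; left; apply/eqP; ring.
Qed.

Lemma orthogonal_scales_ratio (al be : nat -> R) (B : R) :
  scale al -> scale be -> orthogonal_scales al be ->
  \forall n \near \oo, B * al n <= be n \/ B * be n <= al n.
Proof.
move=> [al0 _] [be0 _] /cvgryPge /(_ (ln (`|B| + 1))).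
apply: filterS => n.
have B1 : 0 < `|B| + 1 by rewrite ltr_wpDl.
have q0 : 0 < be n / al n by rewrite divr_gt0.
have BB : B <= `|B| + 1 by rewrite (le_trans (ler_norm B))// lerDl.
have fin x y : 0 < x -> (`|B| + 1) * x <= y -> B * x <= y.
  by move=> x0; apply: le_trans; rewrite ler_pM2r.
rewrite ler_normr => /orP[h|h]; [left|right]; apply: fin => //.
  by rewrite -ler_pdivlMr// -ler_ln.
have q0' : 0 < al n / be n by rewrite divr_gt0.
rewrite -ler_pdivlMr// -ler_ln//.
by apply: (le_trans h); rewrite -lnV ?posrE// invf_div.
Qed.

Section Family.
Variables (l : nat) (alpha : 'I_l -> nat -> R) (psi : 'I_l -> R -> R).
Hypothesis halpha : forall j, scale (alpha j).
Hypothesis hpsi : forall j, profile (psi j).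
Hypothesis horth : forall i j, i != j -> orthogonal_scales (alpha i) (alpha j).

Local Notation h i n := (height (alpha i n) (psi i)).

Lemma heights_decouple_near (eta : R) : 0 < eta ->
  \forall n \near \oo, forall i k : 'I_l, i != k -> forall ri rk rho,
    0 <= ri <= rho -> 0 <= rk <= rho ->
    h i n ri <= eta * Num.sqrt rho \/ h k n rk <= eta * Num.sqrt rho.
Proof.
move=> eta0; apply: filter_forall => i; apply: filter_forall => k.
have [->|ik] := eqVneq i k; first by apply: nearW.
have [B1 B10 hB1] := heights_decouple (hpsi i) (hpsi k) eta0.
have [B2 B20 hB2] := heights_decouple (hpsi k) (hpsi i) eta0.
have := orthogonal_scales_ratio (Num.max B1 B2) (halpha i) (halpha k) (horth ik).
apply: filterS => n hn _ ri rk rho hri hrk.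
have ai : 0 < alpha i n by case: (halpha i).
have ak : 0 < alpha k n by case: (halpha k).
case: hn => hn.
  apply: hB1 => //; apply: le_trans hn.
  by rewrite ler_pM2r// le_max lexx.
have : h k n rk <= eta * Num.sqrt rho \/ h i n ri <= eta * Num.sqrt rho.
  apply: hB2 => //; apply: le_trans hn.
  by rewrite ler_pM2r// le_max lexx orbT.
by case; [right|left].
Qed.

Lemma sum_heights_small (eta K : R) : 0 < eta -> 0 <= K ->
  \forall n \near \oo, forall r : 'I_l -> R, (forall i, 0 <= r i <= K) ->
    \sum_(i < l) h i n (r i) <= eta.
Proof.
move=> eta0 K0.
have eps0 : 0 < eta / (l%:R * Num.sqrt K + 1).
  by rewrite divr_gt0// ltr_wpDl// mulr_ge0 ?sqrtr_ge0.
have : \forall n \near \oo, forall (i : 'I_l) r, 0 <= r <= K ->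
    h i n r <= eta / (l%:R * Num.sqrt K + 1) * Num.sqrt K.
  apply: filter_forall => i.
  have [a a0 ha] := profile_near0 (hpsi i) eps0.
  have [al0 /cvgryPge /(_ (K / a))] := halpha i.
  apply: filterS => n Ka r /andP[r0 rK].
  apply: (@le_trans _ _ (eta / (l%:R * Num.sqrt K + 1) * Num.sqrt r)); last first.
    by rewrite ler_pM2l// ler_wsqrtr.
  apply: height_le => //; apply: ha; rewrite divr_ge0 ?(ltW (al0 n))//=.
  by rewrite ler_pdivrMr// (le_trans rK)// mulrC -ler_pdivrMr.
apply: filterS => n hn r hr.
apply: (@le_trans _ _ (\sum_(i < l) (eta / (l%:R * Num.sqrt K + 1) * Num.sqrt K))).
  by apply: ler_sum => i _; exact: hn.
have d0 : 0 < l%:R * Num.sqrt K + 1 by rewrite ltr_wpDl// mulr_ge0 ?sqrtr_ge0.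
rewrite sumr_const card_ord -[leLHS]mulr_natl.
rewrite [leLHS](_ : _ = eta * ((l%:R * Num.sqrt K) / (l%:R * Num.sqrt K + 1))).
  by rewrite -[leRHS]mulr1 ler_pM2l// ler_pdivrMr// mul1r lerDl.
by field; rewrite gt_eqF.
Qed.

(** Only one of the heights can be large: the others are absorbed by [eta]. *)
Lemma sum_heights_le (M eta : R) (m : 'I_l -> R) : 0 <= M -> 0 < eta ->
  (forall j, is_maximum
    [set `|psi j s| / Num.sqrt s | s in [set s : R | 0 < s]] (m j)) ->
  (forall j, m j <= M) ->
  \forall n \near \oo, forall (r : 'I_l -> R) rho, (forall i, 0 <= r i <= rho) ->
    \sum_(i < l) h i n (r i) <= (M + eta) * Num.sqrt rho.
Proof.
move=> M0 eta0 mm mM.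
have l0 : 0 < l%:R + 1 :> R by rewrite ltr_wpDl.
have eps0 : 0 < eta / (l%:R + 1) by rewrite divr_gt0.
have := heights_decouple_near eps0; apply: filterS => n hn r rho hr.
have [|/forallNP all] := pselect (exists k, eta / (l%:R + 1) * Num.sqrt rho < h k n (r k)).
  move=> [k hk]; rewrite (bigD1 k)//= mulrDl lerD//.
    have /andP[rk0 rkrho] := hr k.
    apply: (le_trans (height_le_max (hpsi k) (mm k) _ rk0)); first by case: (halpha k).
    by apply: ler_pM; rewrite ?sqrtr_ge0 ?(profile_max_ge0 (mm k)) ?ler_wsqrtr.
  apply: (@le_trans _ _ (\sum_(i < l | i != k) (eta / (l%:R + 1) * Num.sqrt rho))).
    apply: ler_sum => i ik; have [//|] := hn i k ik _ _ _ (hr i) (hr k).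
    by rewrite leNgt hk.
  apply: (@le_trans _ _ (\sum_(i < l) (eta / (l%:R + 1) * Num.sqrt rho))).
    rewrite [leRHS](bigD1 k)//= lerDr mulr_ge0 ?sqrtr_ge0//.
    by rewrite ltW.
  rewrite sumr_const card_ord -[leLHS]mulr_natl mulrA ler_wpM2r ?sqrtr_ge0//.
  by rewrite mulrCA -[leRHS]mulr1 ler_pM2l// ler_pdivrMr// mul1r lerDl.
apply: (@le_trans _ _ (\sum_(i < l) (eta / (l%:R + 1) * Num.sqrt rho))).
  by apply: ler_sum => i _; rewrite leNgt; apply/negP; exact: all.
rewrite sumr_const card_ord -[leLHS]mulr_natl mulrA ler_wpM2r ?sqrtr_ge0//.
apply: (@le_trans _ _ eta); last by rewrite lerDr.
by rewrite mulrCA -[leRHS]mulr1 ler_pM2l// ler_pdivrMr// mul1r lerDl.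
Qed.

(** The decoupling, seen from an index whose height is known to be large. *)
Lemma sum_other_heights_le (j : 'I_l) (mu eta : R) : 0 < mu -> 0 < eta ->
  \forall n \near \oo, forall (r : 'I_l -> R) rho, 0 < rho ->
    (forall i, 0 <= r i <= rho) -> mu * Num.sqrt rho <= h j n (r j) ->
    \sum_(i < l | i != j) h i n (r i) <= eta * Num.sqrt rho.
Proof.
move=> mu0 eta0.
have l0 : 0 < l%:R + 1 :> R by rewrite ltr_wpDl.
have eps0 : 0 < Num.min (mu / 2) (eta / (l%:R + 1)) by rewrite lt_min !divr_gt0.
have := heights_decouple_near eps0; apply: filterS => n hn r rho rho0 hr hj.
have sr0 : 0 < Num.sqrt rho by rewrite sqrtr_gt0.
apply: (@le_trans _ _ (\sum_(i < l | i != j) (eta / (l%:R + 1) * Num.sqrt rho))).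
  apply: ler_sum => i ij; have [hi|hj'] := hn i j ij _ _ _ (hr i) (hr j).
    by apply: (le_trans hi); rewrite ler_pM2r// ge_min lexx orbT.
  have := le_trans hj hj'; rewrite ler_pM2r// le_min => /andP[h _].
  by exfalso; lra.
apply: (@le_trans _ _ (\sum_(i < l) (eta / (l%:R + 1) * Num.sqrt rho))).
  rewrite [leRHS](bigD1 j)//= lerDr mulr_ge0 ?sqrtr_ge0//.
  by rewrite ltW// divr_gt0.
rewrite sumr_const card_ord -[leLHS]mulr_natl mulrA ler_wpM2r ?sqrtr_ge0//.
by rewrite mulrCA -[leRHS]mulr1 ler_pM2l// ler_pdivrMr// mul1r lerDl.
Qed.

End Family.
End Heights.

(** * Logarithmic distance and squares in the plane *)

Section Plane.
Context {R : realType}.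
Implicit Types (x c : R * R) (psi : R -> R).

(** The truncation at [0] does not affect the values of a profile at
    [logdist c x / a], because profiles vanish on the negative half-line. *)
Definition logdist c x : R := Num.max 0 (- ln (enorm (x - c))).

Definition square c (rho : R) : set (R * R) :=
  `[c.1 - rho, c.1 + rho] `*` `[c.2 - rho, c.2 + rho].

Lemma enorm_ge0 x : 0 <= enorm x.
Proof. exact: sqrtr_ge0. Qed.

Lemma normr_fst_le_enorm x : `|x.1| <= enorm x.
Proof. by rewrite /enorm -sqrtr_sqr ler_wsqrtr// lerDl sqr_ge0. Qed.

Lemma normr_snd_le_enorm x : `|x.2| <= enorm x.
Proof. by rewrite /enorm -sqrtr_sqr ler_wsqrtr// lerDr sqr_ge0. Qed.

Lemma enorm_le_add x : enorm x <= `|x.1| + `|x.2|.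
Proof.
have p : 0 <= `|x.1| + `|x.2| by rewrite addr_ge0.
rewrite /enorm -[leRHS](ger0_norm p) -sqrtr_sqr ler_wsqrtr// sqrrD.
rewrite !real_normK ?num_real// addrAC lerDl.
by rewrite mulrn_wge0// mulr_ge0.
Qed.

Lemma squareP c rho x : square c rho x <-> `|x.1 - c.1| <= rho /\ `|x.2 - c.2| <= rho.
Proof.
rewrite /square /setX /= !in_itv/= !ler_distl.
by split=> -[].
Qed.

Lemma enorm_square c rho x : enorm (x - c) <= rho -> square c rho x.
Proof.
move=> h; apply/squareP; split; apply: le_trans h.
  exact: (normr_fst_le_enorm (x - c)).
exact: (normr_snd_le_enorm (x - c)).
Qed.

Lemma square_enorm c rho x : square c (rho / 2) x -> enorm (x - c) <= rho.
Proof.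
move=> /squareP[h1 h2]; apply: (le_trans (enorm_le_add (x - c))).
by rewrite [leRHS](splitr rho) lerD.
Qed.

Lemma measurable_square c rho :
  measurable (square c rho : set (measurableTypeR R * measurableTypeR R)).
Proof. by apply: measurableX. Qed.

Lemma leb2_square c rho : 0 < rho -> leb2 R (square c rho) = (4 * rho ^+ 2)%:E.
Proof.
move=> rho0.
have E (a : R) : @lebesgue_measure R (`[a - rho, a + rho]%classic : set R) = (2 * rho)%:E.
  rewrite lebesgue_measure_itv /= lte_fin ltrD2l gtrN// -EFinB; congr (_%:E).
  by ring.
transitivity ((2 * rho)%:E * (2 * rho)%:E)%E; last first.
  by rewrite -EFinM; congr (_%:E); ring.
by rewrite -{1}(E c.1) -(E c.2); apply: product_measure1E.
Qed.

Lemma logdist_ge0 c x : 0 <= logdist c x.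
Proof. by rewrite le_max lexx. Qed.

Lemma logdist_gt0 c x : 0 < logdist c x -> enorm (x - c) = expR (- logdist c x).
Proof.
rewrite /logdist lt_max ltxx/= => h.
rewrite max_r ?ltW// opprK lnK// posrE lt_neqAle enorm_ge0 andbT eq_sym.
by apply/negP => /eqP e0; move: h; rewrite e0 ln0// oppr0 ltxx.
Qed.

Lemma logdist_le c x s : 0 <= s -> expR (- s) <= enorm (x - c) -> logdist c x <= s.
Proof.
move=> s0 h; rewrite /logdist ge_max s0/= lerNl -ler_expR lnK//.
by rewrite posrE (lt_le_trans _ h)// expR_gt0.
Qed.

Lemma logdist_ge c x s : 0 < enorm (x - c) -> enorm (x - c) <= expR (- s) ->
  s <= logdist c x.
Proof.
move=> e0 h; rewrite /logdist le_max; apply/orP; right.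
by rewrite lerNr -ler_expR lnK.
Qed.

Lemma concentrationE psi (a : R) c x : profile psi -> 0 < a ->
  concentration a c psi x =
    (Num.sqrt (2 * pi))^-1 * (Num.sqrt a * psi (logdist c x / a)).
Proof.
move=> ppsi a0; rewrite /concentration.
rewrite sqrtrM ?(ltW a0)// sqrtrV; last by rewrite mulr_ge0 ?pi_ge0.
suff -> : psi (- ln (enorm (x - c)) / a) = psi (logdist c x / a) by ring.
rewrite /logdist; have [h|h] := ltP 0 (- ln (enorm (x - c))).
  by rewrite ?max_r ?ltW.
rewrite mul0r (profile0 ppsi (lexx 0)) (profile0 ppsi)//.
by rewrite pmulr_lle0// invr_gt0.
Qed.

Lemma concentration_norm psi (a : R) c x : profile psi -> 0 < a ->
  `|concentration a c psi x| = (Num.sqrt (2 * pi))^-1 * height a psi (logdist c x).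
Proof.
move=> ppsi a0; rewrite concentrationE// /height normrM; congr (_ * _).
  by rewrite ger0_norm// invr_ge0 sqrtr_ge0.
by rewrite normrM ger0_norm// sqrtr_ge0.
Qed.

Lemma measurable_enorm_sub c : measurable_fun
  [set: measurableTypeR R * measurableTypeR R] (fun x => enorm ((x : R * R) - c)).
Proof.
rewrite /enorm; apply: measurableT_comp.
  by apply: continuous_measurable_fun; exact: sqrt_continuous.
by apply: measurable_funD; apply: measurable_funX;
  (apply: measurable_funB; [|exact: measurable_cst]).
Qed.

Lemma measurable_concentration psi (a : R) c : continuous psi -> measurable_fun
  [set: measurableTypeR R * measurableTypeR R] (concentration a c psi).
Proof.
move=> cpsi; rewrite /concentration; apply: measurable_funM; first exact: measurable_cst.
apply: (@measurableT_comp _ _ _ _ _ _ psi); first exact: continuous_measurable_fun.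
apply: measurable_funM; last exact: measurable_cst.
apply: measurableT_comp => //.
apply: (@measurableT_comp _ _ _ _ _ _ (@ln R)); first exact: measurable_ln.
exact: measurable_enorm_sub.
Qed.

End Plane.

(** * The Orlicz norm *)

Section Orlicz.
Context {R : realType}.
Implicit Types (u : R * R -> R) (lam : R).
Local Notation T := (measurableTypeR R * measurableTypeR R)%type.

Definition moser u lam : \bar R :=
  (\int[leb2 R]_x (expR (`|u x| ^+ 2 / lam ^+ 2) - 1)%:E)%E.

Lemma moser_integrand_ge0 u lam x : 0 <= expR (`|u x| ^+ 2 / lam ^+ 2) - 1.
Proof. by rewrite subr_ge0 -expR0 ler_expR divr_ge0// sqr_ge0. Qed.

Lemma measurable_moser u lam : measurable_fun [set: T] (u : T -> R) ->
  measurable_fun [set: T] (fun x : T => (expR (`|u x| ^+ 2 / lam ^+ 2) - 1)%:E).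
Proof.
move=> mu; apply/measurable_EFinP; apply: measurable_funB; last exact: measurable_cst.
apply: (@measurableT_comp _ _ _ _ _ _ (@expR R)).
  by apply: continuous_measurable_fun; exact: continuous_expR.
apply: measurable_funM; last exact: measurable_cst.
by apply: measurable_funX; apply: measurableT_comp.
Qed.

Lemma orlicz_norm_le u lam : 0 < lam -> (moser u lam <= kappa R)%E ->
  (orlicz_norm u <= lam%:E)%E.
Proof. by move=> lam0 h; apply: ereal_inf_lbound; exists lam. Qed.

Lemma orlicz_norm_ge u lam : measurable_fun [set: T] (u : T -> R) ->
  0 < lam -> (kappa R < moser u lam)%E -> (lam%:E <= orlicz_norm u)%E.
Proof.
move=> mu lam0 h; apply: le_ereal_inf_tmp => _ [lam' [lam'0 h'] <-].
rewrite lee_fin leNgt; apply/negP => ll.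
suff : (moser u lam <= moser u lam')%E.
  by rewrite leNgt (le_lt_trans _ h).
apply: ge0_le_integral => //.
- by move=> x _; rewrite lee_fin moser_integrand_ge0.
- exact: measurable_moser.
- exact: measurable_moser.
move=> x _; rewrite lee_fin lerD2r ler_expR ler_wpM2l ?sqr_ge0//.
by rewrite lef_pV2 ?posrE ?exprn_gt0// lerXn2r ?nnegrE ?(ltW lam0) ?(ltW lam'0)// ltW.
Qed.

Lemma orlicz_norm_ge0 u : (0 <= orlicz_norm u)%E.
Proof.
by apply: le_ereal_inf_tmp => _ [lam [lam0 _] <-]; rewrite lee_fin ltW.
Qed.

(** The Orlicz norm is only sensitive to the threshold between parameters for
    which the integrals become small and those for which they blow up. *)
Lemma orlicz_norm_cvg (u : nat -> R * R -> R) (L : R) : 0 <= L ->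
  (forall n, measurable_fun [set: T] (u n : T -> R)) ->
  (forall lam, L < lam -> \forall n \near \oo, (moser (u n) lam <= kappa R)%E) ->
  (forall lam, 0 < lam < L -> \forall n \near \oo, (kappa R < moser (u n) lam)%E) ->
  orlicz_norm (u n) @[n --> \oo] --> L%:E.
Proof.
move=> L0 mu hup hlo.
have up e : 0 < e -> \forall n \near \oo, (orlicz_norm (u n) <= (L + e)%:E)%E.
  move=> e0; apply: filterS (hup (L + e) _); last by rewrite ltrDl.
  by move=> n; apply: orlicz_norm_le; rewrite ltr_wpDl.
have lo e : 0 < e -> \forall n \near \oo, ((L - e)%:E <= orlicz_norm (u n))%E.
  move=> e0; have [Le|Le] := leP (L - e) 0.
    by apply: nearW => n; apply: le_trans (orlicz_norm_ge0 _); rewrite lee_fin.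
  apply: filterS (hlo (L - e) _); last by rewrite Le ltrBlDr ltrDl.
  by move=> n; apply: orlicz_norm_ge.
apply/fine_cvgP; split.
  have := up 1 ltr01; apply: filterS => n hn.
  by rewrite ge0_fin_numE ?orlicz_norm_ge0// (le_lt_trans hn)// ltry.
apply/cvgrPdist_le => e e0.
near=> n; rewrite distrC ler_distl.
have h1 : (orlicz_norm (u n) <= (L + e)%:E)%E by near: n; exact: up.
have h2 : ((L - e)%:E <= orlicz_norm (u n))%E by near: n; exact: lo.
have fn : orlicz_norm (u n) \is a fin_num.
  by rewrite ge0_fin_numE ?orlicz_norm_ge0// (le_lt_trans h1)// ltry.
by rewrite -!lee_fin /= fineK// h1 h2.
Unshelve. all: by end_near. Qed.

End Orlicz.

(** * Small and large exponential integrals *)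

Section MoserEstimates.
Context {R : realType}.
Local Notation T := (measurableTypeR R * measurableTypeR R)%type.

Lemma integral_scaled_square (c : R * R) (rho k : R) : 0 <= k -> 0 < rho ->
  (\int[leb2 R]_x (k * \1_(square c rho) x)%:E = (4 * (k * rho ^+ 2))%:E)%E.
Proof.
move=> k0 rho0; under eq_integral do rewrite EFinM.
rewrite ge0_integralZl_EFin//; last first.
  by apply/measurable_EFinP; apply: measurable_indic; exact: measurable_square.
rewrite integral_indic//; last exact: measurable_square.
rewrite setIT leb2_square// -EFinM; congr (_%:E); ring.
Qed.

(** Integrals of functions dominated by a step function on the concentric
    squares of half-side [exp (- k)]; this discretization replaces the
    integration of a power of the distance in polar coordinates. *)
Lemma integral_le_squares (l : nat) (core : 'I_l -> R * R) (F : R * R -> R)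
    (c : nat -> R) (C : R) :
  measurable_fun [set: T] (F : T -> R) -> (forall x, 0 <= F x) ->
  (forall k, 0 <= c k) ->
  (forall N, \sum_(0 <= k < N) c k * expR (- k%:R) ^+ 2 <= C) ->
  (forall x, F x = 0 \/
    exists j k, square (core j) (expR (- k%:R)) x /\ F x <= c k) ->
  (\int[leb2 R]_x (F x)%:E <= (l%:R * (4 * C))%:E)%E.
Proof.
move=> mF F0 c0 sumC FQ.
pose f j k (x : T) : \bar R := (c k * \1_(square (core j) (expR (- k%:R))) x)%:E.
have f0 j k x : (0 <= f j k x)%E by rewrite lee_fin mulr_ge0.
have mf j k : measurable_fun [set: T] (f j k).
  apply/measurable_EFinP; apply: measurable_funM; first exact: measurable_cst.
  by apply: measurable_indic; exact: measurable_square.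
have mfs j : measurable_fun [set: T] (fun x => \sum_(k <oo) f j k x)%E.
  by apply: ge0_emeasurable_sum.
have fs0 j x : (0 <= \sum_(k <oo) f j k x)%E by apply: nneseries_ge0.
apply: (@le_trans _ _ (\int[leb2 R]_x (\sum_(j < l) \sum_(k <oo) f j k x))%E).
  apply: ge0_le_integral => //.
  - by move=> x _; rewrite lee_fin.
  - exact/measurable_EFinP.
  - by apply: emeasurable_sum.
  move=> x _; have [->|[j [k [xQ Fc]]]] := FQ x.
    by apply: sume_ge0.
  rewrite (bigD1 j)//=; apply: (@le_trans _ _ (f j k x)).
    by rewrite lee_fin indicE mem_set// mulr1.
  apply: (@le_trans _ _ (\sum_(k <oo) f j k x)%E); last first.
    by apply: leeDl; apply: sume_ge0.
  apply: (@le_trans _ _ (\sum_(0 <= i < k.+1) f j i x)%E); last first.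
    by apply: nneseries_lim_ge.
  by rewrite big_nat_recr//=; apply: leeDr; apply: sume_ge0.
rewrite ge0_integral_sum//.
apply: (@le_trans _ _ (\sum_(j < l) (4 * C)%:E)%E); last first.
  by rewrite sumEFin sumr_const card_ord -[(4 * C) *+ l]mulr_natl.
apply: lee_sum => j _.
rewrite integral_nneseries//.
apply: lime_le; first by apply: is_cvg_nneseries => k _ _; apply: integral_ge0.
apply: nearW => N.
under eq_bigr do rewrite integral_scaled_square ?expR_gt0//.
by rewrite sumEFin lee_fin -mulr_sumr ler_pM2l.
Qed.

Section Family.
Variables (l : nat) (alpha : 'I_l -> nat -> R) (core : 'I_l -> nat -> R * R).
Variables (psi : 'I_l -> R -> R) (m : 'I_l -> R).
Hypothesis halpha : forall j, scale (alpha j).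
Hypothesis hpsi : forall j, profile (psi j).
Hypothesis horth : forall i j, i != j -> orthogonal_scales (alpha i) (alpha j).
Hypothesis hm : forall j, is_maximum
  [set `|psi j s| / Num.sqrt s | s in [set s : R | 0 < s]] (m j).

Let g (n : nat) (x : R * R) : R :=
  \sum_(j < l) concentration (alpha j n) (core j n) (psi j) x.

Let alpha_gt0 j n : 0 < alpha j n. Proof. by case: (halpha j). Qed.

Let pi2 : 0 < 2 * pi :> R. Proof. by rewrite mulr_gt0// pi_gt0. Qed.

Lemma measurable_superposition n : measurable_fun [set: T] (g n : T -> R).
Proof.
apply: measurable_sum => j; apply: measurable_concentration.
exact: profile_continuous.
Qed.

Let norm_le n x :
  `|g n x| <= (Num.sqrt (2 * pi))^-1 *
    \sum_(j < l) height (alpha j n) (psi j) (logdist (core j n) x).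
Proof.
rewrite mulr_sumr; apply: (le_trans (ler_norm_sum _ _ _)).
by apply: ler_sum => j _; rewrite concentration_norm.
Qed.

Let sqr_le n x (b : R) : 0 <= b ->
  \sum_(j < l) height (alpha j n) (psi j) (logdist (core j n) x) <= b ->
  `|g n x| ^+ 2 <= b ^+ 2 / (2 * pi).
Proof.
move=> b0 hb.
have s0 : 0 < (Num.sqrt (2 * pi))^-1 :> R by rewrite invr_gt0 sqrtr_gt0.
have : `|g n x| <= (Num.sqrt (2 * pi))^-1 * b.
  by apply: (le_trans (norm_le n x)); rewrite ler_pM2l.
move=> h; rewrite -(sqr_sqrtr (ltW pi2)) -exprVn -exprMn mulrC.
by rewrite lerXn2r ?nnegrE ?normr_ge0// mulr_ge0// ltW.
Qed.

(** With [r] the largest of the logarithmic distances to the cores, the exponent is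
    at most [2 * theta * r] for some [theta < 1], whence a bound by a power of the
    distance to the nearest core that is integrable in the plane.  It makes the
    integral over deep squares small; on the remaining bounded range of [r] the
    superposition tends uniformly to [0]. *)
Lemma moser_small (M lam kap : R) : 0 <= M -> (forall j, m j <= M) -> 0 < lam ->
  M ^+ 2 < 4 * pi * lam ^+ 2 -> 0 < kap ->
  \forall n \near \oo, (moser (g n) lam <= kap%:E)%E.
Proof.
move=> M0 mM lam0 Mlam kap0.
have lam2 : 0 < lam ^+ 2 by rewrite exprn_gt0.
have pl : 0 < 4 * pi * lam ^+ 2 by rewrite !mulr_gt0// pi_gt0.
(* [theta < 1] leaves room between [M] and the threshold. *)
pose D := Num.sqrt (4 * pi * lam ^+ 2).
have MD : M < D.
  by rewrite -(ger0_norm M0) -sqrtr_sqr ltr_sqrt.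
pose eta := (D - M) / 2.
have eta0 : 0 < eta by rewrite divr_gt0// subr_gt0.
pose theta := (M + eta) ^+ 2 / (4 * pi * lam ^+ 2).
have MeD : M + eta < D by rewrite /eta; lra.
have Me0 : 0 <= M + eta by rewrite addr_ge0// ltW.
have theta1 : theta < 1.
  rewrite /theta ltr_pdivrMr// mul1r -(sqr_sqrtr (ltW pl)) -/D.
  by rewrite ltrXn2r// ?nnegrE// ltW// (le_lt_trans Me0).
have theta0 : 0 <= theta by rewrite divr_ge0 ?sqr_ge0// ltW.
pose p : R := expR (theta - 1).
have p0 : 0 < p by exact: expR_gt0.
have p1 : p < 1 by rewrite -expR0 ltr_expR subr_lt0.
pose l' : R := l%:R + 1.
have l'0 : 0 < l' by rewrite ltr_wpDl.
pose kap' := kap / (8 * l').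
have kap'0 : 0 < kap' by rewrite divr_gt0// mulr_gt0.
(* [K] makes the tail of the geometric series small. *)
have [K hK] : exists K : nat, expR (2 * theta) * (p ^+ K.+1 / (1 - p)) <= kap'.
  have : (fun n => expR (2 * theta) / (1 - p) * p ^+ n) @ \oo --> (0 : R).
    by apply: cvg_geometric; rewrite gtr0_norm.
  move=> /cvgrPdist_le /(_ _ kap'0) [N _ /(_ N.+1 (leqnSn N))].
  rewrite sub0r normrN => h; exists N; apply: le_trans h.
  by rewrite -mulrA [(1 - p)^-1 * _]mulrC ler_norm.
pose delta := ln (1 + kap').
have delta0 : 0 < delta by rewrite ln_gt0// ltrDl.
pose eps := Num.sqrt (delta * (2 * pi) * lam ^+ 2).
have eps0 : 0 < eps by rewrite sqrtr_gt0 !mulr_gt0// pi_gt0.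
have near1 := sum_heights_le halpha hpsi horth M0 eta0 hm mM.
have near2 := sum_heights_small halpha hpsi eps0 (ler0n R K.+1).
near=> n.
have h1 : forall (r : 'I_l -> R) rho, (forall i, 0 <= r i <= rho) ->
    \sum_(i < l) height (alpha i n) (psi i) (r i) <= (M + eta) * Num.sqrt rho.
  by near: n.
have h2 : forall r : 'I_l -> R, (forall i, 0 <= r i <= K.+1%:R) ->
    \sum_(i < l) height (alpha i n) (psi i) (r i) <= eps.
  by near: n.
(* The square of index [0] carries the range [r <= K.+1], and the squares of index
   beyond [K] carry the power of the distance. *)
pose c k : R := if k == 0%N then kap' else
  if (k <= K)%N then 0 else expR (2 * theta * k.+1%:R).
have c0 k : 0 <= c k.
  by rewrite /c; case: ifP => _; [exact: ltW|case: ifP => // _; exact: expR_ge0].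
apply: (@le_trans _ _ (l%:R * (4 * (2 * kap')))%:E); last first.
  rewrite lee_fin /kap'.
  rewrite [leLHS](_ : _ = kap * (l%:R / l')).
    by rewrite -[leRHS]mulr1 ler_pM2l// ler_pdivrMr// mul1r lerDl.
  by field; rewrite gt_eqF.
apply: (@integral_le_squares l (core ^~ n) _ c) => //.
- by apply/measurable_EFinP; apply: measurable_moser; exact: measurable_superposition.
- by move=> x; exact: moser_integrand_ge0.
- move=> N; rewrite [leRHS](_ : _ = kap' + kap'); last by ring.
  apply: (@le_trans _ _ (\sum_(0 <= k < N) ((if k == 0%N then kap' else 0) +
      expR (2 * theta) * p ^+ K.+1 * p ^+ k))).
    apply: ler_sum => k _; rewrite /c.
    have q0 j : 0 <= expR (2 * theta) * p ^+ K.+1 * p ^+ j :> R.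
      by rewrite !mulr_ge0 ?exprn_ge0 ?expR_ge0// ltW.
    case: ifPn => [/eqP->|_].
      by rewrite oppr0 expR0 expr1n mulr1 lerDl.
    case: ifPn => [_|]; first by rewrite mul0r add0r.
    rewrite -ltnNge => Kk; rewrite add0r.
    have -> : expR (2 * theta * k.+1%:R) * expR (- k%:R) ^+ 2 =
        expR (2 * theta) * (p ^+ k * p ^+ k).
      rewrite -!expRM_natl -!expRD; congr expR.
      by rewrite -[k.+1]addn1 natrD; ring.
    rewrite -mulrA ler_pM2l ?expR_gt0// ler_pM2r ?exprn_gt0//.
    by rewrite ler_wiXn2l// ltW.
  rewrite big_split/=; apply: lerD.
    case: N => [|N]; first by rewrite big_geq// ltW.
    by rewrite big_nat_recl//= big1 ?addr0.
  rewrite -mulr_sumr; apply: le_trans hK.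
  rewrite -mulrA ler_pM2l ?expR_gt0// ler_pM2l ?exprn_gt0//.
  have := congr1 (@^~ N) (geometric_seriesE 1 (negbT (lt_eqF p1))).
  rewrite /series/= mul1r; under eq_bigr do rewrite mul1r.
  move=> ->; rewrite ler_pdivrMr ?subr_gt0// mulVf ?gt_eqF ?subr_gt0//.
  by rewrite lerBlDr lerDl exprn_ge0// ltW.
move=> x; pose r i := logdist (core i n) x.
have r0 i : 0 <= r i by exact: logdist_ge0.
have bound (b y : R) : 0 <= b -> b ^+ 2 / (2 * pi) <= y * lam ^+ 2 ->
    \sum_(i < l) height (alpha i n) (psi i) (r i) <= b ->
    expR (`|g n x| ^+ 2 / lam ^+ 2) - 1 <= expR y - 1.
  move=> b0 hby hb; rewrite lerD2r ler_expR ler_pdivrMr//.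
  by apply: le_trans hby; apply: sqr_le.
have [r_eq0|/existsNP[i0 /eqP ri0]] := pselect (forall i, r i = 0).
  left; apply/eqP; rewrite eq_le moser_integrand_ge0 andbT.
  apply: (@le_trans _ _ (expR 0 - 1)); last by rewrite expR0 subrr.
  apply: (bound 0) => //; first by rewrite expr0n/= mul0r mul0r.
  have := h1 r 0; rewrite sqrtr0 mulr0; apply => i.
  by rewrite r_eq0 lexx.
have [j _ jmax] := @arg_maxP _ _ _ i0 xpredT r isT.
have rj0 : 0 < r j.
  by rewrite (lt_le_trans _ (jmax i0 isT))// lt_neqAle eq_sym ri0 r0.
have rr i : 0 <= r i <= r j by rewrite r0; exact: jmax.
right; exists j; have enj := logdist_gt0 rj0.
have [rK|Kr] := leP (r j) K.+1%:R.
  exists 0%N; split.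
    by apply: enorm_square; rewrite enj ler_expR lerN2 ltW.
  rewrite /c eqxx; apply: (@le_trans _ _ (expR delta - 1)); last first.
    by rewrite lnK ?posrE ?addr_gt0// addrAC subrr add0r.
  apply: (bound eps); first exact: ltW.
    rewrite sqr_sqrtr; last by rewrite !mulr_ge0 ?pi_ge0// ltW.
    by rewrite mulrAC mulfK// gt_eqF.
  by apply: h2 => i; have /andP[-> /=] := rr i; move/le_trans; apply.
have /andP[kr rk] := truncn_itv (ltW rj0).
have Kk : (K < Num.truncn (r j))%N.
  by rewrite -ltnS -(ltr_nat R) (lt_trans Kr).
exists (Num.truncn (r j)); split.
  by apply: enorm_square; rewrite enj ler_expR lerN2.
rewrite /c gtn_eqF; last exact: leq_ltn_trans Kk.
rewrite leqNgt Kk/=; apply: (@le_trans _ _ (expR (2 * theta * r j) - 1)).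
  apply: (bound ((M + eta) * Num.sqrt (r j))).
  - by rewrite mulr_ge0// sqrtr_ge0.
  - rewrite exprMn sqr_sqrtr ?r0// /theta le_eqVlt; apply/orP; left; apply/eqP.
    by move: (pi_gt0 R); move: pi => q q0; field; rewrite !gt_eqF.
  - exact: h1.
apply: (@le_trans _ _ (expR (2 * theta * r j))); first by rewrite lerBlDr lerDl.
by rewrite ler_expR; apply: ler_wpM2l; [rewrite mulr_ge0|exact: ltW].
Unshelve. all: by end_near. Qed.


Let norm_ge n x (j : 'I_l) :
  (Num.sqrt (2 * pi))^-1 * (height (alpha j n) (psi j) (logdist (core j n) x) -
    \sum_(i < l | i != j) height (alpha i n) (psi i) (logdist (core i n) x)) <=
  `|g n x|.
Proof.
rewrite mulrBr -concentration_norm// mulr_sumr lerBlDr.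
have -> : concentration (alpha j n) (core j n) (psi j) x =
    g n x - \sum_(i < l | i != j) concentration (alpha i n) (core i n) (psi i) x.
  by rewrite /g (bigD1 j)//= addrK.
apply: (le_trans (ler_normB _ _)); rewrite lerD2l.
apply: (le_trans (ler_norm_sum _ _ _)).
by apply: ler_sum => i _; rewrite concentration_norm.
Qed.

(** Let [s0] maximize the quotient of [psi j] by the square root, and [s1 < s0] be
    close to it.  On the square of half-side [expR (- s1 * a) / 2] around the core
    [j], with the much smaller squares of half-side [expR (- s0 * a)] around all
    the cores removed, every logarithmic distance is at most [s0 * a] and the height
    of index [j] is nearly maximal.  The exponent exceeds [2 * theta * s0 * a] there
    for some [theta > 1], which beats the area. *)
Lemma moser_large (j : 'I_l) (lam A : R) : 0 < lam ->
  4 * pi * lam ^+ 2 < m j ^+ 2 ->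
  \forall n \near \oo, (A%:E < moser (g n) lam)%E.
Proof.
move=> lam0 lamm.
have lam2 : 0 < lam ^+ 2 by rewrite exprn_gt0.
have pl : 0 < 4 * pi * lam ^+ 2 by rewrite !mulr_gt0// pi_gt0.
pose D := Num.sqrt (4 * pi * lam ^+ 2).
have D0 : 0 < D by rewrite sqrtr_gt0.
have mj0 : 0 <= m j by exact: profile_max_ge0 (hm j).
have Dm : D < m j.
  by rewrite -(ger0_norm mj0) -sqrtr_sqr ltr_sqrt// (lt_trans pl).
pose mu := (D + m j) / 2; pose eta := (m j - D) / 4.
have mu0 : 0 < mu by rewrite /mu; lra.
have mum : mu < m j by rewrite /mu; lra.
have eta0 : 0 < eta by rewrite /eta; lra.
have nuD : D < mu - eta by rewrite /mu /eta; lra.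
have nu0 : 0 < mu - eta by exact: lt_trans nuD.
pose theta := (mu - eta) ^+ 2 / (4 * pi * lam ^+ 2).
have theta1 : 1 < theta.
  rewrite /theta ltr_pdivlMr// mul1r -(sqr_sqrtr (ltW pl)) -/D.
  by rewrite ltrXn2r// ?nnegrE// ltW.
have theta0 : 0 < theta by exact: lt_trans theta1.
have [s0 s00 psis0] := profile_max_attained (hm j).
have [s1 [s10 s1s0 psi_ge]] : exists s1, [/\ 0 < s1, s1 < s0 &
    forall s, s1 <= s <= s0 -> mu * Num.sqrt s0 <= `|psi j s|].
  have : \forall s \near s0, mu * Num.sqrt s0 <= `|psi j s|.
    have : (fun s => `|psi j s|) @ s0 --> `|psi j s0|.
      by apply: cvg_norm; exact: (profile_continuous (hpsi j)).
    by move=> /cvgr_ge; apply; rewrite psis0 ltr_pM2r ?sqrtr_gt0.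
  move=> /nbhs_ballP[r /= r0 hr].
  exists (Num.max (s0 / 2) (s0 - r / 2)); split.
  - by rewrite lt_max divr_gt0.
  - by rewrite gt_max; apply/andP; split; lra.
  move=> s /andP[]; rewrite ge_max => /andP[_ h1] h2; apply: hr.
  by rewrite /ball/= ger0_norm ?subr_ge0//; lra.
have s01 : 0 < s0 - s1 by rewrite subr_gt0.
have t1 : 0 < theta - 1 by rewrite subr_gt0.
have [_ alphay] := halpha j.
have alpha_ge (B : R) : \forall n \near \oo, B <= alpha j n.
  by move/cvgryPge : alphay.
have near3 := sum_other_heights_le halpha hpsi horth j mu0 eta0.
near=> n.
have a0 : 0 < alpha j n by exact: alpha_gt0.
have h3 : forall (r : 'I_l -> R) rho, 0 < rho -> (forall i, 0 <= r i <= rho) ->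
    mu * Num.sqrt rho <= height (alpha j n) (psi j) (r j) ->
    \sum_(i < l | i != j) height (alpha i n) (psi i) (r i) <= eta * Num.sqrt rho.
  by near: n.
have a1 : 4 * l%:R <= 2 * (s0 - s1) * alpha j n.
  by rewrite [leRHS]mulrC -ler_pdivrMr ?mulr_gt0//; near: n; exact: alpha_ge.
have a2 : 1 <= 2 * s0 * alpha j n.
  by rewrite [leRHS]mulrC -ler_pdivrMr ?mulr_gt0//; near: n; exact: alpha_ge.
have a3 : 2 * `|A| <= 2 * (theta - 1) * s0 * alpha j n.
  by rewrite [leRHS]mulrC -ler_pdivrMr ?mulr_gt0//; near: n; exact: alpha_ge.
set a := alpha j n in a0 h3 a1 a2 a3 *.
pose V := expR (2 * theta * s0 * a) - 1.
pose rho := expR (- (s1 * a)); pose sigma := expR (- (s0 * a)).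
have rho0 : 0 < rho by exact: expR_gt0.
have sigma0 : 0 < sigma by exact: expR_gt0.
have V0 : 0 <= V.
  rewrite subr_ge0 -[leLHS]expR0 ler_expR; do 2![apply: mulr_ge0; last exact: ltW].
  by apply: mulr_ge0 => //; exact: ltW theta0.
have pointwise x : V * \1_(square (core j n) (rho / 2)) x <=
    (expR (`|g n x| ^+ 2 / lam ^+ 2) - 1) +
    \sum_(i < l) V * \1_(square (core i n) sigma) x.
  have sum0 : 0 <= \sum_(i < l) V * \1_(square (core i n) sigma) x.
    by apply: sumr_ge0 => i _; rewrite mulr_ge0.
  have F0 := moser_integrand_ge0 (g n) lam x.
  have [xQ|xQ] := pselect (square (core j n) (rho / 2) x); last first.
    by rewrite indicE memNset// mulr0 addr_ge0.
  rewrite indicE mem_set// mulr1.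
  have [[i xi]|out] := pselect (exists i, square (core i n) sigma x).
    rewrite (bigD1 i)//= indicE mem_set// mulr1 addrCA lerDl addr_ge0//.
    by apply: sumr_ge0 => k _; rewrite mulr_ge0.
  have far i : sigma <= enorm (x - core i n).
    rewrite leNgt; apply/negP => h; apply: out; exists i.
    by apply: enorm_square; exact: ltW.
  apply: ler_wpDr => //; rewrite lerD2r ler_expR.
  have rle i : 0 <= logdist (core i n) x <= s0 * a.
    by rewrite logdist_ge0/=; apply: logdist_le; [rewrite mulr_ge0// ltW|exact: far].
  have rge : s1 * a <= logdist (core j n) x.
    apply: logdist_ge; first exact: lt_le_trans (far j).
    exact: square_enorm.
  have sa : 0 < s0 * a by rewrite mulr_gt0.
  have hj : mu * Num.sqrt (s0 * a) <= height a (psi j) (logdist (core j n) x).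
    rewrite sqrtrM ?(ltW s00)// /height [leRHS]mulrC mulrA ler_pM2r ?sqrtr_gt0//.
    apply: psi_ge; rewrite ler_pdivlMr// ler_pdivrMr// rge /=.
    by have /andP[] := rle j.
  have ho := h3 _ _ sa rle hj.
  have gge : (Num.sqrt (2 * pi))^-1 * ((mu - eta) * Num.sqrt (s0 * a)) <= `|g n x|.
    apply: le_trans (norm_ge n x j).
    by rewrite ler_pM2l ?invr_gt0 ?sqrtr_gt0// mulrBl lerB.
  rewrite ler_pdivlMr//.
  have -> : 2 * theta * s0 * a * lam ^+ 2 =
      ((Num.sqrt (2 * pi))^-1 * ((mu - eta) * Num.sqrt (s0 * a))) ^+ 2.
    rewrite !exprMn exprVn !sqr_sqrtr ?(ltW sa) ?(ltW pi2)// /theta.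
    by move: (pi_gt0 R); move: pi => q q0; field; rewrite !gt_eqF.
  rewrite lerXn2r ?nnegrE//; first by rewrite !mulr_ge0 ?invr_ge0 ?sqrtr_ge0// ltW.
have mF := measurable_moser lam (measurable_superposition n).
have mQ (c : R * R) (s : R) : measurable_fun [set: T] (fun x : T => (V * \1_(square c s) x)%:E).
  apply/measurable_EFinP; apply: measurable_funM; first exact: measurable_cst.
  by apply: measurable_indic; exact: measurable_square.
pose S (x : T) : \bar R := (\sum_(i < l) (V * \1_(square (core i n) sigma) x)%:E)%E.
have S0 x : (0 <= S x)%E by apply: sume_ge0 => i _; rewrite lee_fin mulr_ge0.
have mS : measurable_fun [set: T] S by exact: emeasurable_sum.
have intS : (\int[leb2 R]_x S x = (l%:R * (4 * (V * sigma ^+ 2)))%:E)%E.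
  rewrite /S ge0_integral_sum//; last by move=> i x _; rewrite lee_fin mulr_ge0.
  under eq_bigr do rewrite integral_scaled_square//.
  by rewrite sumEFin sumr_const card_ord; congr (_%:E); rewrite [RHS]mulr_natl.
have int_le : ((V * rho ^+ 2)%:E <= moser (g n) lam + (l%:R * (4 * (V * sigma ^+ 2)))%:E)%E.
  rewrite -intS.
  have -> : (V * rho ^+ 2)%:E =
      (\int[leb2 R]_x (V * \1_(square (core j n) (rho / 2)) x)%:E)%E.
    by rewrite integral_scaled_square ?divr_gt0//; congr (_%:E); field.
  have Fe0 x : [set: T] x -> (0 <= (expR (`|g n x| ^+ 2 / lam ^+ 2) - 1)%:E)%E.
    by move=> _; rewrite lee_fin moser_integrand_ge0.
  have /esym := ge0_integralD (leb2 R) measurableT Fe0 mF (fun x _ => S0 x) mS.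
  rewrite -/(moser (g n) lam) => ->.
  apply: ge0_le_integral => //.
  - by move=> x _; rewrite lee_fin mulr_ge0.
  - exact: emeasurable_funD.
  by move=> x _; rewrite /S sumEFin -EFinD lee_fin.
rewrite -leeBlDr// -EFinB in int_le.
apply: lt_le_trans int_le; rewrite lte_fin.
have -> : V * rho ^+ 2 - l%:R * (4 * (V * sigma ^+ 2)) =
    V * sigma ^+ 2 * (expR (2 * (s0 - s1) * a) - 4 * l%:R).
  have -> : rho ^+ 2 = sigma ^+ 2 * expR (2 * (s0 - s1) * a).
    by rewrite -!expRM_natl -expRD; congr expR; ring.
  by ring.
have b1 : 1 <= expR (2 * (s0 - s1) * a) - 4 * l%:R.
  rewrite lerBrDr; apply: (@le_trans _ _ (1 + 2 * (s0 - s1) * a)); first by rewrite lerD2l.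
  exact: expR_ge1Dx.
have b2 : expR (2 * theta * s0 * a) / 2 <= V.
  have : 2 <= expR (2 * theta * s0 * a).
    apply: (@le_trans _ _ (1 + 2 * theta * s0 * a)); last exact: expR_ge1Dx.
    have : 2 * s0 * a <= theta * (2 * s0 * a).
      by rewrite ler_peMl// ?(ltW theta1)// (le_trans ler01).
    have -> : theta * (2 * s0 * a) = 2 * theta * s0 * a by ring.
    by lra.
  by rewrite /V; lra.
have b3 : A < expR (2 * theta * s0 * a) / 2 * sigma ^+ 2.
  rewrite mulrAC -expRM_natl -expRD.
  have -> : 2 * theta * s0 * a + 2%:R * - (s0 * a) = 2 * (theta - 1) * s0 * a by ring.
  have := expR_ge1Dx (2 * (theta - 1) * s0 * a).
  by have := ler_norm A; lra.
apply: (lt_le_trans b3).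
rewrite -[leLHS]mulr1; apply: ler_pM => //.
  by rewrite mulr_ge0 ?exprn_ge0 ?divr_ge0 ?expR_ge0.
by rewrite ler_pM2r// exprn_gt0.
Unshelve. all: by end_near. Qed.

End Family.
End MoserEstimates.

(** * Positivity of the Moser-Trudinger constant *)

Section Kappa.
Context {R : realType}.
Local Notation T := (measurableTypeR R * measurableTypeR R)%type.
Local Notation mu := (@lebesgue_measure R).

(** The Borel sets of the plane are in the product of the Borel
    sigma-algebras: an open set is a countable union of rational boxes. *)
Lemma open_measurable2 (U : set (R * R)) : open U -> measurable (U : set T).
Proof.
move=> oU.
pose box (q : (rat * rat) * (rat * rat)) : set T :=
  `]ratr q.1.1, ratr q.1.2[ `*` `]ratr q.2.1, ratr q.2.2[.
have -> : U = \bigcup_q (if pselect (box q `<=` U) then box q else set0).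
  rewrite eqEsubset; split; last first.
    by move=> x [q _]; case: pselect => // qU /qU.
  move=> [x y] Uxy.
  have /nbhs_ballP[e /= e0 eU] : nbhs (x, y) U by apply: open_nbhs_nbhs.
  have rat_near (z : R) : exists a b : rat, [/\ ratr a < z, z < ratr b &
      forall w, ratr a < w -> w < ratr b -> `|z - w| < e].
    have [a] := @rat_in_itvoo R (z - e) z ltac:(by rewrite ltrBlDr ltrDl).
    rewrite in_itv/= => /andP[a1 a2].
    have [b] := @rat_in_itvoo R z (z + e) ltac:(by rewrite ltrDl).
    rewrite in_itv/= => /andP[b1 b2].
    exists a, b; split => // w aw wb.
    by rewrite ltr_distl; apply/andP; split; lra.
  have [a [b [ax xb abx]]] := rat_near x.
  have [c [d [cy yd cdy]]] := rat_near y.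
  exists ((a, b), (c, d)) => //; case: pselect => [h|[]].
    by split; rewrite /= in_itv/= ?ax ?cy.
  move=> [w1 w2] [] /=; rewrite !in_itv/= => /andP[h1 h2] /andP[h3 h4].
  by apply: eU; split => /=; [exact: abx|exact: cdy].
apply: countable_bigcupT_measurable; first exact: countableP.
move=> q.
case: pselect => [h|_] /=; last exact: measurable0.
by rewrite /box; apply: measurableX; exact: measurable_itv.
Qed.

Lemma continuous_measurable2 (f : R * R -> R) : continuous f ->
  measurable_fun [set: T] (f : T -> R).
Proof.
move=> cf mD; apply: (measurability _ (RGenOInfty.measurableE R)) => //.
move=> /= _ [_ [x ->] <-]; rewrite setTI; apply: open_measurable2.
apply: open_comp; last exact: interval_open.
by move=> z _; exact: cf.
Qed.

Lemma Lnorm2_sqr d (S : measurableType d) (m : {measure set S -> \bar R})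
    (f : S -> R) :
  ('N[m]_(2%:E)[EFin \o f] ^+ 2 = \int[m]_x (f x ^+ 2)%:E)%E.
Proof.
have := @poweR_Lnorm _ _ _ m (EFin \o f) 2 ltac:(by rewrite pnatr_eq0).
have -> : (\int[m]_x (`|(EFin \o f) x| `^ 2) = \int[m]_x (f x ^+ 2)%:E)%E.
  by apply: eq_integral => x _ /=; rewrite powR_mulrn// real_normK// num_real.
have := Lnorm_ge0 m 2%:E (EFin \o f).
case: ('N[m]_(2%:E)[EFin \o f])%E => [r| |] //.
  by rewrite lee_fin => r0 <-; rewrite /= powR_mulrn.
by move=> _ <-; rewrite expe2 mulyy poweRyr// pnatr_eq0.
Qed.

Lemma integrable_unit_square (f : R * R -> R) (C : R) :
  measurable_fun [set: T] (f : T -> R) ->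
  (forall x, ~ square (2^-1, 2^-1) 2^-1 x -> f x = 0) -> (forall x, `|f x| <= C) ->
  (leb2 R).-integrable [set: T] (EFin \o (f : T -> R)).
Proof.
move=> mf f0 fC; set Q := square (2^-1, 2^-1) (2^-1 : R) in f0 *.
have C0 : 0 <= C by apply: le_trans (fC (0, 0)).
apply/integrableP; split; first exact/measurable_EFinP.
apply: (@le_lt_trans _ _ (\int[leb2 R]_x (C * \1_Q x)%:E)%E); last first.
  by rewrite integral_scaled_square// ltry.
apply: ge0_le_integral => //.
- by apply: measurableT_comp => //; exact/measurable_EFinP.
- apply/measurable_EFinP; apply: measurable_funM; first exact: measurable_cst.
  by apply: measurable_indic; exact: measurable_square.
move=> x _; rewrite lee_fin indicE.
have [xQ|xQ] := pselect (Q x); first by rewrite mem_set// mulr1.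
by rewrite f0// normr0 mulr_ge0.
Qed.

Lemma unit_squareP (x : R * R) :
  square (2^-1, 2^-1) 2^-1 x <-> 0 <= x.1 <= 1 /\ 0 <= x.2 <= 1.
Proof.
rewrite squareP/= !ler_distl; split=> -[/andP[h1 h2] /andP[h3 h4]].
  by split; apply/andP; split; lra.
by split; apply/andP; split; lra.
Qed.

Lemma bounded_bump : exists db : R -> R, exists C : R,
  [/\ forall x, is_derive x (1 : R) (@bump R) (db x), continuous db,
      forall x, ~ 0 <= x <= 1 -> db x = 0, 1 <= C &
      forall x, `|bump x| <= C /\ `|db x| <= C].
Proof.
have [db dB cdb] := @smooth_bump R 1.
have cb : continuous (@bump R) := is_derive_continuous dB.
have bound (f : R -> R) : continuous f -> (forall x, ~ 0 <= x <= 1 -> f x = 0) ->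
    exists C, forall x, `|f x| <= C.
  move=> cf f0.
  have cnf : {within `[0, 1], continuous (fun x => `|f x|)}.
    by apply: continuous_subspaceT => x; apply: cvg_norm; exact: cf.
  have [c _ cmax] := EVT_max (@ler01 R) cnf.
  exists `|f c| => x; have [x01|x01] := pselect (0 <= x <= 1).
    by apply: cmax; rewrite in_itv.
  by rewrite f0// normr0.
have b0 x : ~ 0 <= x <= 1 -> bump x = 0 :> R.
  move=> x01; apply: bump_out; have [x0|x0] := leP x 0; [by left|right].
  by rewrite leNgt; apply/negP => x1; apply: x01; rewrite !ltW.
have db0 x : ~ 0 <= x <= 1 -> db x = 0.
  move=> x01; case: (dB x) => _ <-.
  suff /near_eq_derive -> : \near x, (@bump R) x = cst (0 : R) x by rewrite derive_cst.
  have [x0|x0] := ltP x 0.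
    near=> y; rewrite bump_out//; left; apply: ltW; near: y; exact: lt_nbhsl.
  have x1 : 1 < x by rewrite ltNge; apply/negP => x1; apply: x01; rewrite x0.
  near=> y; rewrite bump_out//; right; apply: ltW; near: y; exact: lt_nbhsr.
have [C1 hC1] := bound _ cb b0.
have [C2 hC2] := bound _ cdb db0.
have C10 : 0 <= C1 by apply: le_trans (hC1 0).
have C20 : 0 <= C2 by apply: le_trans (hC2 0).
exists db, (C1 + C2 + 1); split => //; first by rewrite lerDr addr_ge0.
move=> x; split; [apply: (le_trans (hC1 x))|apply: (le_trans (hC2 x))]; lra.
Unshelve. all: by end_near. Qed.

Lemma is_derive_fst (phi : R * R -> R) (y x : R) : derivable phi (x, y) (1, 0) ->
  is_derive x (1 : R) (fun t => phi (t, y)) ('D_(1, 0) phi (x, y)).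
Proof.
have E : (fun h : R => h^-1 *: (phi (h *: (1, 0) + (x, y)) - phi (x, y))) =
    (fun h : R => h^-1 *: (phi (h *: 1 + x, y) - phi (x, y))).
  apply/funext => h; congr (_ *: (phi _ - _)).
  rewrite (_ : _ + _ = (h *: (1 : R) + x, h *: (0 : R) + y)) //.
  by rewrite scaler0 add0r.
by rewrite /derivable /derive E => d; split.
Qed.

Lemma is_derive_snd (phi : R * R -> R) (x y : R) : derivable phi (x, y) (0, 1) ->
  is_derive y (1 : R) (fun t => phi (x, t)) ('D_(0, 1) phi (x, y)).
Proof.
have E : (fun h : R => h^-1 *: (phi (h *: (0, 1) + (x, y)) - phi (x, y))) =
    (fun h : R => h^-1 *: (phi (x, h *: 1 + y) - phi (x, y))).
  apply/funext => h; congr (_ *: (phi _ - _)).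
  rewrite (_ : _ + _ = (h *: (0 : R) + x, h *: (1 : R) + y)) //.
  by rewrite scaler0 add0r.
by rewrite /derivable /derive E => d; split.
Qed.

Lemma integral_by_parts_supported (b db f df : R -> R) (k : R) :
  (forall x, is_derive x (1 : R) b (db x)) -> continuous db ->
  (forall x, ~ 0 < x < 1 -> b x = 0) -> (forall x, ~ 0 <= x <= 1 -> db x = 0) ->
  (forall x, is_derive x (1 : R) f (df x)) -> continuous df ->
  (\int[mu]_x (k * (b x * df x))%:E = \int[mu]_x (- k * (db x * f x))%:E)%E.
Proof.
move=> dB cdb b0 db0 dF cdf.
have cb := is_derive_continuous dB; have cf := is_derive_continuous dF.
have supp (h : R -> R) : (forall x, ~ 0 <= x <= 1 -> h x = 0) ->
    (\int[mu]_x (h x)%:E = \int[mu]_(x in `[0%R, 1%R]) (h x)%:E)%E.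
  move=> h0; rewrite [RHS]integral_mkcond; apply: eq_integral => x _.
  rewrite patchE; case: ifPn => // /negP x01; rewrite h0// => x01'.
  by apply: x01; rewrite inE/= in_itv.
rewrite supp; last first.
  move=> x x01; rewrite b0 ?mul0r ?mulr0// => /andP[h1 h2]; apply: x01.
  by rewrite !ltW.
rewrite supp; last by move=> x x01; rewrite db0// mul0r mulr0.
have cM (f1 f2 : R -> R) : continuous f1 -> continuous f2 ->
    continuous (fun x => f1 x * f2 x).
  by move=> c1 c2 x; apply: cvgM; [exact: c1|exact: c2].
under eq_integral do rewrite EFinM.
rewrite integralZl//; last by apply: continuous_integrable_segment; exact: cM.
under [in RHS]eq_integral do rewrite EFinM.
rewrite integralZl//; last by apply: continuous_integrable_segment; exact: cM.
rewrite (@integration_by_parts R b f db df 0 1)//.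
- have -> : b 0 = 0 by apply: b0; rewrite ltxx.
  have -> : b 1 = 0 by apply: b0; rewrite ltxx andbF.
  by rewrite !mul0r subrr sub0e muleN EFinN mulNe.
- exact: continuous_subspaceT.
- exact: is_derive_derivable_oo dB.
- by move=> x _; rewrite (is_derive_derive1 dB).
- exact: continuous_subspaceT.
- exact: is_derive_derivable_oo dF.
- by move=> x _; rewrite (is_derive_derive1 dF).
Qed.

Lemma continuous_bounded_square (f : R * R -> R) : continuous f ->
  exists K, forall x, square (2^-1, 2^-1) 2^-1 x -> `|f x| <= K.
Proof.
move=> cf; set Q := square _ _.
have cQ : compact Q by apply: compact_setX; exact: segment_compact.
have Q0 : Q !=set0.
  by exists (0, 0); apply/unit_squareP; rewrite /= lexx ler01.
have cnf : {within Q, continuous (fun x => `|f x|)}.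
  by apply: continuous_subspaceT => x; apply: cvg_norm; exact: cf.
have [c _ cmax] := compact_EVT_max Q0 cQ cnf.
by exists `|f c| => x xQ; apply: cmax; rewrite inE.
Qed.

Lemma integral_sqr_unit_square (f : R * R -> R) (B : R) :
  measurable_fun [set: T] (f : T -> R) ->
  (forall x, ~ square (2^-1, 2^-1) 2^-1 x -> f x = 0) -> (forall x, `|f x| <= B) ->
  (\int[leb2 R]_x (f x ^+ 2)%:E <= (B ^+ 2)%:E)%E.
Proof.
move=> mf f0 fB; set Q := square (2^-1, 2^-1) (2^-1 : R) in f0 *.
have B0 : 0 <= B by apply: le_trans (fB (0, 0)).
have -> : (B ^+ 2)%:E = (\int[leb2 R]_x (B ^+ 2 * \1_Q x)%:E)%E.
  by rewrite integral_scaled_square ?sqr_ge0//; congr (_%:E); field.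
apply: ge0_le_integral => //.
- by move=> x _; rewrite lee_fin sqr_ge0.
- by apply/measurable_EFinP; exact: measurable_funX.
- apply/measurable_EFinP; apply: measurable_funM; first exact: measurable_cst.
  by apply: measurable_indic; exact: measurable_square.
move=> x _; rewrite lee_fin indicE.
have [xQ|xQ] := pselect (Q x); last by rewrite f0// expr0n/= mulr_ge0 ?sqr_ge0.
by rewrite mem_set// mulr1 -(real_normK (num_real (f x))) lerXn2r ?nnegrE.
Qed.

Lemma Lfun2_unit_square (f : R * R -> R) (B : R) :
  measurable_fun [set: T] (f : T -> R) ->
  (forall x, ~ square (2^-1, 2^-1) 2^-1 x -> f x = 0) -> (forall x, `|f x| <= B) ->
  (f : T -> R) \in Lfun (leb2 R) 2%:E.
Proof.
move=> mf f0 fB; rewrite inE; apply/andP; split; first by rewrite inE.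
rewrite inE/= /finite_norm.
have := integral_sqr_unit_square mf f0 fB; rewrite -Lnorm2_sqr.
by case: ('N[_]_(_)[_])%E (Lnorm_ge0 (leb2 R) 2%:E (EFin \o (f : T -> R))) => [r| |]//;
  rewrite ?ltry// expe2 mulyy leye_eq.
Qed.

Section WeakGradient.
Variables (b db : R -> R) (C c : R).
Hypotheses (dB : forall x, is_derive x (1 : R) b (db x)) (cdb : continuous db).
Hypotheses (b0 : forall x, ~ 0 < x < 1 -> b x = 0).
Hypotheses (db0 : forall x, ~ 0 <= x <= 1 -> db x = 0).
Hypotheses (bC : forall x, `|b x| <= C) (dbC : forall x, `|db x| <= C).

Let cb : continuous b := is_derive_continuous dB.

Let b0' x : ~ 0 <= x <= 1 -> b x = 0.
Proof.
by move=> x01; apply: b0 => /andP[h1 h2]; apply: x01; rewrite !ltW.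
Qed.

Definition tensor (f g : R -> R) (x : R * R) : R := c * (f x.1 * g x.2).

Lemma measurable_tensor (f g : R -> R) : continuous f -> continuous g ->
  measurable_fun [set: T] (tensor f g : T -> R).
Proof.
move=> cf cg; apply: measurable_funM; first exact: measurable_cst.
apply: measurable_funM.
  by apply: (@measurableT_comp _ _ _ _ _ _ f); first exact: continuous_measurable_fun.
by apply: (@measurableT_comp _ _ _ _ _ _ g); first exact: continuous_measurable_fun.
Qed.

Lemma tensor_out (f g : R -> R) x : (forall y, ~ 0 <= y <= 1 -> f y = 0) ->
  (forall y, ~ 0 <= y <= 1 -> g y = 0) -> ~ square (2^-1, 2^-1) 2^-1 x ->
  tensor f g x = 0.
Proof.
move=> f0 g0 xQ; rewrite /tensor.
have [x1|x1] := pselect (0 <= x.1 <= 1); last by rewrite f0// mul0r mulr0.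
have [x2|x2] := pselect (0 <= x.2 <= 1); last by rewrite g0// !mulr0.
by exfalso; apply: xQ; apply/unit_squareP.
Qed.

Lemma tensor_bound (f g : R -> R) x : (forall y, `|f y| <= C) -> (forall y, `|g y| <= C) ->
  `|tensor f g x| <= `|c| * (C * C).
Proof.
by move=> fC gC; rewrite !normrM ler_wpM2l// ler_pM.
Qed.

Let integrable_tensor (f g : R -> R) (h : R * R -> R) (k : R) : continuous f -> continuous g ->
  (forall y, ~ 0 <= y <= 1 -> f y = 0) -> (forall y, ~ 0 <= y <= 1 -> g y = 0) ->
  (forall y, `|f y| <= C) -> (forall y, `|g y| <= C) -> continuous h ->
  (leb2 R).-integrable [set: T] (EFin \o (fun x : T => k * (tensor f g x * h x))).
Proof.
move=> cf cg f0 g0 fC gC ch; have [K hK] := continuous_bounded_square ch.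
apply: (@integrable_unit_square _ (`|k| * (`|c| * (C * C) * `|K|))).
- apply: measurable_funM; first exact: measurable_cst.
  apply: measurable_funM; first exact: measurable_tensor.
  exact: continuous_measurable2.
- by move=> x xQ; rewrite tensor_out// mul0r mulr0.
move=> x; rewrite normrM ler_wpM2l// normrM.
have [xQ|xQ] := pselect (square (2^-1, 2^-1) 2^-1 x); last first.
  by rewrite tensor_out// normr0 mul0r !mulr_ge0// (le_trans _ (fC 0)).
apply: ler_pM => //; first exact: tensor_bound.
by apply: (le_trans (hK x xQ)); exact: ler_norm.
Qed.

Let neg_integral (f g : R -> R) (h : R * R -> R) : continuous f -> continuous g ->
  (forall y, ~ 0 <= y <= 1 -> f y = 0) -> (forall y, ~ 0 <= y <= 1 -> g y = 0) ->
  (forall y, `|f y| <= C) -> (forall y, `|g y| <= C) -> continuous h ->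
  (- (\int[leb2 R]_x (tensor f g x * h x)%:E) =
   \int[leb2 R]_x (- 1 * (tensor f g x * h x))%:E)%E.
Proof.
move=> cf cg f0 g0 fC gC ch; under [RHS]eq_integral do rewrite EFinM.
rewrite integralZl//; first by rewrite EFinN mulN1e.
have := integrable_tensor 1 cf cg f0 g0 fC gC ch.
by apply: eq_integrable => // x _ /=; rewrite mul1r.
Qed.

(** On each horizontal or vertical line this is an integration by parts in one
    variable, and the slices are reassembled by Fubini's theorem. *)
Lemma weak_gradient_tensor :
  weak_gradient (tensor b b) (fun x => (tensor db b x, tensor b db x)).
Proof.
move=> phi [sphi _].
have cphi : continuous phi := sphi 0%N.
have [_ dphi] := sphi 1%N.
have [d10 c10] := dphi (1, 0); have [d01 c01] := dphi (0, 1).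
have restrict1 (h : R * R -> R) y : continuous h -> continuous (fun x => h (x, y)).
  move=> ch x; apply: (@continuous_comp _ _ _ (fun x => (x, y)) h); last exact: ch.
  by apply: (@cvg_pair _ _ _ (nbhs x) (nbhs x) (nbhs y) _ _ _ id (cst y));
    [exact: cvg_id|exact: cvg_cst].
have restrict2 (h : R * R -> R) x : continuous h -> continuous (fun y => h (x, y)).
  move=> ch y; apply: (@continuous_comp _ _ _ (fun y => (x, y)) h); last exact: ch.
  by apply: (@cvg_pair _ _ _ (nbhs y) (nbhs x) (nbhs y) _ _ _ (cst x) id);
    [exact: cvg_cst|exact: cvg_id].
have iL h : continuous h ->
    (leb2 R).-integrable [set: T] (EFin \o (fun x : T => tensor b b x * h x)).
  move=> ch; have := integrable_tensor 1 cb cb b0' b0' bC bC ch.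
  by apply: eq_integrable => // x _ /=; rewrite mul1r.
split.
- rewrite /= neg_integral//.
  rewrite -(integral21_prod_meas1 (iL _ c10)).
  rewrite -(integral21_prod_meas1 (integrable_tensor (-1) cdb cb db0 b0' dbC bC cphi)).
  apply: eq_integral => y _ /=.
  have := integral_by_parts_supported (c * b y) dB cdb b0 db0
    (fun x => is_derive_fst (d10 (x, y))) (restrict1 _ y c10).
  move=> E; transitivity (\int[mu]_x (c * b y * (b x * 'D_(1, 0) phi (x, y)))%:E)%E.
    by apply: eq_integral => x _; congr (_%:E); rewrite /tensor/=; ring.
  rewrite E; apply: eq_integral => x _; congr (_%:E); rewrite /tensor/=; ring.
- rewrite /= neg_integral//.
  rewrite -(integral12_prod_meas1 (iL _ c01)).
  rewrite -(integral12_prod_meas1 (integrable_tensor (-1) cb cdb b0' db0 bC dbC cphi)).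
  apply: eq_integral => x _ /=.
  have := integral_by_parts_supported (c * b x) dB cdb b0 db0
    (fun y => is_derive_snd (d01 (x, y))) (restrict2 _ x c01).
  move=> E; transitivity (\int[mu]_y (c * b x * (b y * 'D_(0, 1) phi (x, y)))%:E)%E.
    by apply: eq_integral => y _; congr (_%:E); rewrite /tensor/=; ring.
  rewrite E; apply: eq_integral => y _; congr (_%:E); rewrite /tensor/=; ring.
Qed.

End WeakGradient.

(** Were the constant zero, the Orlicz norm of every function that is not almost
    everywhere zero would be infinite.  A small multiple of a tensor product of
    bumps is a nonzero function in the unit ball of the Sobolev space. *)
Lemma kappa_gt0 : (0 < kappa R)%E.
Proof.
have [db [C [dB cdb db0 C1 bound]]] := bounded_bump.
have cb : continuous (@bump R) := is_derive_continuous dB.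
have bC x : `|bump x| <= C by case: (bound x).
have dbC x : `|db x| <= C by case: (bound x).
have b0 x : ~ 0 < x < 1 -> bump x = 0 :> R.
  move=> x01; apply: bump_out; have [x0|x0] := leP x 0; [by left|right].
  by rewrite leNgt; apply/negP => x1; apply: x01; rewrite x0.
have b0' x : ~ 0 <= x <= 1 -> bump x = 0 :> R.
  by move=> x01; apply: b0 => /andP[h1 h2]; apply: x01; rewrite !ltW.
have C0 : 0 < C by rewrite (lt_le_trans ltr01).
pose c : R := (4 * (C * C))^-1.
have c0 : 0 < c by rewrite invr_gt0 !mulr_gt0.
have cC : `|c| * (C * C) = 4^-1.
  by rewrite gtr0_norm// /c; field; rewrite gt_eqF.
pose u := tensor c (@bump R) (@bump R).
pose du x := (tensor c db (@bump R) x, tensor c (@bump R) db x).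
have uB x : `|u x| <= 4^-1 by rewrite -cC; exact: tensor_bound.
have d1B x : `|(du x).1| <= 4^-1 by rewrite -cC; exact: tensor_bound.
have d2B x : `|(du x).2| <= 4^-1 by rewrite -cC; exact: tensor_bound.
have mu0 : measurable_fun [set: T] (u : T -> R) by exact: measurable_tensor.
have md1 : measurable_fun [set: T] (fst \o du : T -> R) by exact: measurable_tensor.
have md2 : measurable_fun [set: T] (snd \o du : T -> R) by exact: measurable_tensor.
have uo x : ~ square (2^-1, 2^-1) 2^-1 x -> u x = 0 by exact: tensor_out.
have d1o x : ~ square (2^-1, 2^-1) 2^-1 x -> (du x).1 = 0 by exact: tensor_out.
have d2o x : ~ square (2^-1, 2^-1) 2^-1 x -> (du x).2 = 0 by exact: tensor_out.
have H1 : H1_gradient u du.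
  split.
  - exact: (Lfun2_unit_square mu0 uo uB).
  - exact: (Lfun2_unit_square md1 d1o d1B).
  - exact: (Lfun2_unit_square md2 d2o d2B).
  - exact: (weak_gradient_tensor c dB cdb b0 db0 bC dbC).
have H1n : (H1_norm_sqr u du <= 1)%E.
  rewrite /H1_norm_sqr !Lnorm2_sqr.
  apply: (@le_trans _ _ ((4^-1 ^+ 2)%:E + (2^-1 ^+ 2)%:E)%E); last first.
    rewrite -EFinD lee_fin; lra.
  apply: leeD; first exact: (integral_sqr_unit_square mu0 uo uB).
  apply: integral_sqr_unit_square.
  - apply: (@measurableT_comp _ _ _ _ _ _ (@Num.sqrt R)).
      by apply: continuous_measurable_fun; exact: sqrt_continuous.
    by apply: measurable_funD; apply: measurable_funX.
  - by move=> x xQ; rewrite /= /enorm d1o// d2o// expr0n/= addr0 sqrtr0.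
  - move=> x; rewrite /= ger0_norm ?enorm_ge0//; apply: (le_trans (enorm_le_add _)).
    by have := d1B x; have := d2B x; lra.
pose v : R := c * (expR (- 8) * expR (- 8)).
have v0 : 0 < v by rewrite !mulr_gt0 ?expR_gt0.
pose V := expR (4 * pi * v ^+ 2) - 1.
have V0 : 0 < V.
  by rewrite subr_gt0 expR_gt1 !mulr_gt0// ?pi_gt0// exprn_gt0.
have qV : (0 < 4 * (V * 4^-1 ^+ 2))%R by rewrite !mulr_gt0// exprn_gt0.
apply: (@lt_le_trans _ _ (\int[leb2 R]_x (expR (4 * pi * `|u x| ^+ 2) - 1)%:E)%E); last first.
  by apply: ereal_sup_ubound; exists u => //; exists du.
apply: (@lt_le_trans _ _ (4 * (V * 4^-1 ^+ 2))%:E); first by rewrite lte_fin.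
rewrite -(integral_scaled_square (2^-1, 2^-1)) ?(ltW V0)//.
have pu x : 0 <= expR (4 * pi * `|u x| ^+ 2) - 1.
  by rewrite subr_ge0 -[leLHS]expR0 ler_expR !mulr_ge0 ?pi_ge0 ?sqr_ge0.
apply: ge0_le_integral => //.
- by move=> x _; rewrite lee_fin mulr_ge0// ltW.
- apply/measurable_EFinP; apply: measurable_funM; first exact: measurable_cst.
  by apply: measurable_indic; exact: measurable_square.
- apply/measurable_EFinP; apply: measurable_funB; last exact: measurable_cst.
  apply: (@measurableT_comp _ _ _ _ _ _ (@expR R)).
    by apply: continuous_measurable_fun; exact: continuous_expR.
  apply: measurable_funM; first exact: measurable_cst.
  by apply: measurable_funX; apply: measurableT_comp.
move=> x _; rewrite lee_fin indicE.
have [/squareP[]|xQ] := pselect (square (2^-1, 2^-1) 4^-1 x); last by rewrite memNset// mulr0.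
rewrite /= !ler_distl => /andP[h1 h2] /andP[h3 h4].
rewrite mem_set ?mulr1; last first.
  by apply/squareP; rewrite /= !ler_distl h1 h2 h3 h4.
rewrite lerD2r ler_expR ler_pM2l ?mulr_gt0 ?pi_gt0//.
rewrite lerXn2r ?nnegrE ?(ltW v0)//.
have low t : 2^-1 - 4^-1 <= t <= 2^-1 + 4^-1 -> expR (- 8) <= bump t :> R.
  move=> /andP[t1 t2]; have t0 : 0 < t by lra.
  have t0' : 0 < 1 - t by lra.
  rewrite /bump /expinv t0 t0' !expr0 !mul1r -expRD ler_expR.
  have i1 : t^-1 <= 4 by rewrite invf_ple ?posrE//; lra.
  have i2 : (1 - t)^-1 <= 4 by rewrite invf_ple ?posrE//; lra.
  lra.
have l1 : expR (- 8) <= bump x.1 :> R by apply: low; rewrite h1 h2.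
have l2 : expR (- 8) <= bump x.2 :> R by apply: low; rewrite h3 h4.
rewrite gtr0_norm.
  by rewrite ler_pM2l// ler_pM// expR_ge0.
by rewrite mulr_gt0// mulr_gt0// (lt_le_trans (expR_gt0 (- 8))).
Qed.

End Kappa.

(** * The limit of the Orlicz norms *)

Section Limit.
Context {R : realType}.
Hypothesis hkappa : (kappa R < +oo)%E.

Lemma orlicz_norm_superposition_cvg (l : nat) (alpha : 'I_l -> nat -> R)
    (core : 'I_l -> nat -> R * R) (psi : 'I_l -> R -> R) (m : 'I_l -> R) (k : 'I_l) :
  (forall j, scale (alpha j)) -> (forall j, profile (psi j)) ->
  (forall i j, i != j -> orthogonal_scales (alpha i) (alpha j)) ->
  (forall j, is_maximum
    [set `|psi j s| / Num.sqrt s | s in [set s : R | 0 < s]] (m j)) ->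
  (forall j, m j <= m k) ->
  orlicz_norm (fun x => \sum_(j < l) concentration (alpha j n) (core j n) (psi j) x)
    @[n --> \oo] --> (1 / Num.sqrt (4 * pi) * m k)%:E.
Proof.
move=> halpha hpsi horth hm mk.
have k0 := @kappa_gt0 R.
have kE : kappa R = (fine (kappa R))%:E by rewrite fineK// ge0_fin_numE// ltW.
have kr : 0 < fine (kappa R) by rewrite fine_gt0// k0.
have s0 : 0 < Num.sqrt (4 * pi) :> R by rewrite sqrtr_gt0 mulr_gt0// pi_gt0.
have s2 : Num.sqrt (4 * pi) ^+ 2 = 4 * pi :> R.
  by rewrite sqr_sqrtr// mulr_ge0// pi_ge0.
have m0 : 0 <= m k by exact: profile_max_ge0 (hm k).
have LE : 1 / Num.sqrt (4 * pi) * m k = m k / Num.sqrt (4 * pi) by rewrite mul1r mulrC.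
have L0 : 0 <= 1 / Num.sqrt (4 * pi) * m k by rewrite LE divr_ge0// ltW.
apply: orlicz_norm_cvg => //.
- by move=> n; exact: measurable_superposition.
- move=> lam lamL; have lam0 : 0 < lam by exact: le_lt_trans lamL.
  rewrite kE; apply: (moser_small core halpha hpsi horth hm m0) => //.
  rewrite -s2 -exprMn ltrXn2r// ?nnegrE ?mulr_ge0 ?(ltW s0) ?(ltW lam0)//.
  by rewrite mulrC -ltr_pdivrMr// -LE.
move=> lam /andP[lam0 lamL]; rewrite kE.
apply: (moser_large core halpha hpsi horth hm (j := k)) => //.
rewrite -s2 -exprMn ltrXn2r// ?nnegrE ?mulr_ge0 ?(ltW s0) ?(ltW lam0)//.
by rewrite mulrC -ltr_pdivlMr// -LE.
Qed.

Lemma orlicz_norm_concentration_cvg (alpha : nat -> R) (core : nat -> R * R)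
    (psi : R -> R) (m : R) : scale alpha -> profile psi ->
  is_maximum [set `|psi s| / Num.sqrt s | s in [set s : R | 0 < s]] m ->
  orlicz_norm (concentration (alpha n) (core n) psi) @[n --> \oo] -->
    (1 / Num.sqrt (4 * pi) * m)%:E.
Proof.
move=> halpha hpsi hm.
have orth1 (i j : 'I_1) : i != j -> orthogonal_scales alpha alpha.
  by rewrite !ord1 eqxx.
have := @orlicz_norm_superposition_cvg 1 (fun=> alpha) (fun=> core) (fun=> psi)
  (fun=> m) ord0 (fun=> halpha) (fun=> hpsi) orth1 (fun=> hm) (fun=> lexx m).
apply: cvg_trans; apply: near_eq_cvg; apply: nearW => n.
by congr orlicz_norm; apply/funext => x; rewrite big_ord1.
Qed.

End Limit.

Theorem proposition1p19 (R : realType) (hkappa : (kappa R < +oo)%E)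
    (l : nat) (hl : (0 < l)%N)
    (alpha : 'I_l -> nat -> R) (core : 'I_l -> nat -> R * R)
    (psi : 'I_l -> R -> R)
    (halpha : forall j, scale (alpha j))
    (hpsi : forall j, profile (psi j))
    (horth : forall i j, i != j -> orthogonal_scales (alpha i) (alpha j)) :
  let gj (j : 'I_l) (n : nat) : R * R -> R :=
    concentration (alpha j n) (core j n) (psi j) in
  let g (n : nat) (x : R * R) : R := \sum_(j < l) gj j n x in
  exists m : 'I_l -> R,
    [/\ forall j, is_maximum
          [set `|psi j s| / Num.sqrt s | s in [set s : R | 0 < s]] (m j),
        forall j, cvgn (fun n => orlicz_norm (gj j n)),
        orlicz_norm (g n) @[n --> \oo] -->
          ereal_sup [set limn (fun n => orlicz_norm (gj j n)) | j in setT] &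
        ereal_sup [set limn (fun n => orlicz_norm (gj j n)) | j in setT] =
          ereal_sup [set (1 / Num.sqrt (4 * pi) * m j)%:E | j in setT]].
Proof.
move=> gj g.
have [m hm] := choice (fun j => profile_max (hpsi j)).
have cj j : orlicz_norm (gj j n) @[n --> \oo] --> (1 / Num.sqrt (4 * pi) * m j)%:E.
  exact: orlicz_norm_concentration_cvg.
have supE : ereal_sup [set limn (fun n => orlicz_norm (gj j n)) | j in setT] =
    ereal_sup [set (1 / Num.sqrt (4 * pi) * m j)%:E | j in setT].
  by congr ereal_sup; apply: eq_imagel => j _; exact: cvg_lim (cj j).
exists m; split => //; first by move=> j; apply/cvg_ex; exists (1 / Num.sqrt (4 * pi) * m j)%:E.
have [k _ kmax] := @arg_maxP _ _ _ (Ordinal hl) xpredT m isT.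
rewrite supE.
have -> : ereal_sup [set (1 / Num.sqrt (4 * pi) * m j)%:E | j in setT] =
    (1 / Num.sqrt (4 * pi) * m k)%:E.
  apply/eqP; rewrite eq_le; apply/andP; split.
    apply: ge_ereal_sup => _ [j _ <-]; rewrite lee_fin ler_wpM2l ?divr_ge0 ?sqrtr_ge0//.
    exact: kmax.
  by apply: ereal_sup_ubound; exists k.
apply: orlicz_norm_superposition_cvg => // j.
exact: kmax.
Qed.
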